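(* Let $H:\mathbb{R}^N\times\mathbb{R}^N\to\mathbb{R}$ be a continuous function satisfying the Standing Assumptions (SA) with constants $C_0,r,R,\alpha$, let $\Omega\subset\mathbb{R}^N$ be an open set, and let $u$ be the viscosity solution of the Dirichlet problem $$H(x,-Du(x))=1\ \text{ in }\Omega,\qquad u(x)=0\ \text{ on }\partial\Omega .$$ Then $u$ is locally $\theta$-semiconcave in $\Omega$ for every $\theta\in\big(0,\frac{\alpha}{4+\alpha}\big)$.
   Context: $\langle\cdot,\cdot\rangle$ and $|\cdot|$ are the Euclidean scalar product and norm on $\mathbb{R}^N$, $N\ge 1$. Standing Assumptions (SA), for positive constants $C_0,r,R$ with $r<R$ and $\alpha\in(0,1/2)$: (i) $|H(x,p)-H(y,p)|\le C_0|x-y|^{2\alpha}|p|$ for all $x,y,p\in\mathbb{R}^N$. (ii) For all $x$, the function $p\mapsto H(x,p)$ is convex on $\mathbb{R}^N$, positively homogeneous of degree one, and $r|p|\le H(x,p)\le R|p|$ for all $p\in\mathbb{R}^N$. (iii) For all $x$, $p\mapsto H(x,p)$ is continuously differentiable on $\mathbb{R}^N\setminus\{0\}$, with gradient in $p$ denoted $D_pH(x,p)$, and for all $p,q\in\mathbb{R}^N\setminus\{0\}$, $$-\frac{1}{2r}|D_pH(x,q)-D_pH(x,p)|^2\le\Big\langle D_pH(x,q)-D_pH(x,p),\frac{p}{|p|}\Big\rangle\le-\frac{1}{2R}|D_pH(x,q)-D_pH(x,p)|^2 .$$ Solution $u$: set $F(x)=\mathrm{co}\{D_pH(x,p): p\in\mathbb{R}^N\setminus\{0\}\}$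 (convex hull). A trajectory is a locally absolutely continuous arc $x(\cdot):[0,\infty)\to\mathbb{R}^N$ with $x'(t)\in F(x(t))$ for a.e. $t\ge0$. The paper takes as well known the existence, uniqueness and Lipschitz continuity of the viscosity solution $u$ of the Dirichlet problem, together with the representation formula $$u(x)=\inf\{t\ge0:\ \exists\, x(\cdot)\text{ trajectory with }x(0)=x,\ x(t)\in\partial\Omega\};$$ ''the viscosity solution $u$'' is the (real-valued) function given by this formula. Definition: a function $v:\Omega\to\mathbb{R}$ is locally $\theta$-semiconcave, $\theta\in(0,1]$, if for every compact convex set $\mathcal{O}\subset\Omega$ there is a constant $C_{\mathcal{O}}$ such that $$v(\lambda x+(1-\lambda)y)\ge\lambda v(x)+(1-\lambda)v(y)-C_{\mathcal{O}}\lambda(1-\lambda)|x-y|^{1+\theta}$$ for all $x,y\in\mathcal{O}$ and $\lambda\in[0,1]$. *)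

(* Defs.v *)
From HB Require Import structures.
From mathcomp Require Import all_boot all_order all_algebra.
From mathcomp Require Import all_classical all_reals all_analysis.
Import Order.TTheory GRing.Theory Num.Theory.
Import numFieldNormedType.Exports.

Set Implicit Arguments.
Unset Strict Implicit.
Unset Printing Implicit Defensive.

Local Open Scope classical_set_scope.
Local Open Scope ring_scope.

(* The library norm on 'rV[R]_N is the sup norm; it induces the usual topology
   and derivatives, but all metric estimates below use the Euclidean norm. *)
Definition dot (R : realType) (N : nat) (v w : 'rV[R]_N) : R :=
  \sum_(i < N) v ord0 i * w ord0 i.

Definition enorm (R : realType) (N : nat) (v : 'rV[R]_N) : R :=
  Num.sqrt (dot v v).

(* D_p H(x, p); only meaningful where [H x] is differentiable at [p]. *)
Definition grad_p (R : realType) (N : nat) (H : 'rV[R]_N -> 'rV[R]_N -> R)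
    (x p : 'rV[R]_N) : 'rV[R]_N :=
  \row_(i < N) 'D_(delta_mx ord0 i) (H x) p.

(* [rmin] and [rmax] are the constants r < R of (ii) and (iii). *)
Record standing_assumptions (R : realType) (N : nat)
    (H : 'rV[R]_N -> 'rV[R]_N -> R) (C0 rmin rmax alpha : R) : Prop := {
  SA_C0 : 0 < C0;
  SA_rmin : 0 < rmin;
  SA_rmin_rmax : rmin < rmax;
  SA_alpha : 0 < alpha < 1 / 2;
  SA_holder : forall x y p : 'rV[R]_N,
    `|H x p - H y p| <= C0 * (enorm (x - y) `^ (2 * alpha)) * enorm p;
  SA_convex : forall x : 'rV[R]_N,
    convex_function [set: convex_lmodType 'rV[R]_N] (H x);
  SA_homogeneous : forall (x p : 'rV[R]_N) (t : R), 0 < t ->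
    H x (t *: p) = t * H x p;
  SA_bounds : forall x p : 'rV[R]_N,
    rmin * enorm p <= H x p /\ H x p <= rmax * enorm p;
  SA_differentiable : forall x p : 'rV[R]_N,
    p != 0 -> differentiable (H x) p;
  SA_grad_continuous : forall x p : 'rV[R]_N,
    p != 0 -> {for p, continuous (grad_p H x)};
  SA_grad_bounds : forall x p q : 'rV[R]_N,
    p != 0 -> q != 0 ->
    let d := grad_p H x q - grad_p H x p in
    - (1 / (2 * rmin)) * enorm d ^+ 2 <= dot d ((enorm p)^-1 *: p) /\
    dot d ((enorm p)^-1 *: p) <= - (1 / (2 * rmax)) * enorm d ^+ 2
}.

Definition convex_hull (R : realType) (N : nat) (A : set 'rV[R]_N) :
    set 'rV[R]_N :=
  smallest (@convex_set R 'rV[R]_N) A.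

Definition velocity_set (R : realType) (N : nat)
    (H : 'rV[R]_N -> 'rV[R]_N -> R) (x : 'rV[R]_N) : set 'rV[R]_N :=
  convex_hull [set grad_p H x p | p in [set p | p != 0]].

Definition abs_continuous (R : realType) (N : nat) (a b : R)
    (X : R -> 'rV[R]_N) : Prop :=
  forall e : R, 0 < e -> exists2 d : R, 0 < d &
    forall (n : nat) (s t : 'I_n -> R),
      (forall i, [/\ a <= s i, s i <= t i & t i <= b]) ->
      trivIset [set: 'I_n] (fun i => `]s i, t i[%classic) ->
      \sum_(i < n) (t i - s i) < d ->
      \sum_(i < n) enorm (X (t i) - X (s i)) < e.

(* Arcs on [0, +oo[ are functions on R whose values at negative times are
   irrelevant: they only affect the two-sided derivative at t = 0. *)
Definition trajectory (R : realType) (N : nat)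
    (H : 'rV[R]_N -> 'rV[R]_N -> R) (X : R -> 'rV[R]_N) : Prop :=
  (forall T : R, 0 <= T -> abs_continuous 0 T X) /\
  {ae @lebesgue_measure R, forall t : R, 0 <= t ->
     derivable X t 1 /\ velocity_set H (X t) (derive1 X t)}.

Definition boundary (T : topologicalType) (A : set T) : set T :=
  closure A `\` interior A.

Definition hitting_times (R : realType) (N : nat)
    (H : 'rV[R]_N -> 'rV[R]_N -> R) (Omega : set 'rV[R]_N) (x : 'rV[R]_N) :
    set R :=
  [set t | 0 <= t /\
    exists X : R -> 'rV[R]_N,
      [/\ trajectory H X, X 0 = x & boundary Omega (X t)]].

(* The viscosity solution of H(x, -Du) = 1 in Omega, u = 0 on the boundary, by
   its representation formula. The infimum is taken in \bar R, so that the
   infimum of the empty set is +oo: u being real-valued is part of the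
   hypothesis. Values of u outside the closure of Omega are irrelevant. *)
Definition dirichlet_solution (R : realType) (N : nat)
    (H : 'rV[R]_N -> 'rV[R]_N -> R) (Omega : set 'rV[R]_N)
    (u : 'rV[R]_N -> R) : Prop :=
  forall x : 'rV[R]_N, closure Omega x ->
    (u x)%:E = ereal_inf [set t%:E | t in hitting_times H Omega x].

Definition locally_semiconcave (R : realType) (N : nat) (theta : R)
    (Omega : set 'rV[R]_N) (v : 'rV[R]_N -> R) : Prop :=
  forall O : set 'rV[R]_N,
    compact O -> convex_set (O : set (convex_lmodType 'rV[R]_N)) ->
    O `<=` Omega ->
    exists C : R, forall (x y : 'rV[R]_N) (lambda : R),
      O x -> O y -> 0 <= lambda <= 1 ->
      lambda * v x + (1 - lambda) * v y
        - C * lambda * (1 - lambda) * (enorm (x - y) `^ (1 + theta))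
      <= v (lambda *: x + (1 - lambda) *: y).

(* Main.v *)
(** Let [F x] be the convex set with support function [H x]; it coincides with
    [velocity_set H x].  The left inequality of [SA_grad_bounds] gives [F x] an
    interior ball of radius [rmin] at each boundary point, so its gauge [rho_x]
    has second differences at most [k |e|^2 / |v|] at [v] in direction [e].

    Let [z] be the midpoint of [x] and [y], let [h = |x - y|], let [X] be a nearly
    optimal trajectory from [z] and [w = X t] with [t] much larger than [h].  By
    Hölder continuity in the first variable, [rho_z (w - z) <= t (1 + a)] with
    [a ~ t^(2 alpha)], while the segments from [x] and [y] to [w] can be followed
    in times [(1 + 2 a) rho_z (w - x)] and [(1 + 2 a) rho_z (w - y)].  Adding up,
    [u x + u y - 2 u z <= C (t^(1 + 2 alpha) + h^2 / t)], and [t = h^(1 - theta)]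
    gives [C h^(1 + theta)] as soon as [theta <= alpha / (1 + alpha)].  Finally,
    midpoint semiconcavity with a power modulus and local boundedness imply
    semiconcavity. *)

Require Import Defs.
From HB Require Import structures.
From mathcomp Require Import all_boot all_order all_algebra.
From mathcomp Require Import all_classical all_reals all_analysis.
From mathcomp Require Import ring lra.
Import Order.TTheory GRing.Theory Num.Theory.
Import numFieldNormedType.Exports.

Local Open Scope classical_set_scope.
Local Open Scope ring_scope.

Set Implicit Arguments.
Unset Strict Implicit.
Unset Printing Implicit Defensive.

(** * Euclidean geometry on row vectors and its comparison with the sup norm *)

Section EuclideanSpace.
Context {R : realType} {N : nat}.
Implicit Types (u v w p q : 'rV[R]_N) (a b : R).

Lemma dotC v w : dot v w = dot w v.
Proof. by apply: eq_bigr => i _; rewrite mulrC. Qed.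

Lemma dotDl u v w : dot (u + v) w = dot u w + dot v w.
Proof. by rewrite -big_split; apply: eq_bigr => i _; rewrite mxE mulrDl. Qed.

Lemma dotZl a v w : dot (a *: v) w = a * dot v w.
Proof. by rewrite mulr_sumr; apply: eq_bigr => i _; rewrite mxE mulrA. Qed.

Lemma dotNl v w : dot (- v) w = - dot v w.
Proof. by rewrite -scaleN1r dotZl mulN1r. Qed.

Lemma dotBl u v w : dot (u - v) w = dot u w - dot v w.
Proof. by rewrite dotDl dotNl. Qed.

Lemma dotDr u v w : dot w (u + v) = dot w u + dot w v.
Proof. by rewrite dotC dotDl !(dotC w). Qed.

Lemma dotZr a v w : dot w (a *: v) = a * dot w v.
Proof. by rewrite dotC dotZl (dotC w). Qed.

Lemma dotNr v w : dot w (- v) = - dot w v.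
Proof. by rewrite dotC dotNl (dotC w). Qed.

Lemma dotBr u v w : dot w (u - v) = dot w u - dot w v.
Proof. by rewrite dotDr dotNr. Qed.

Lemma dot0l w : dot 0 w = 0.
Proof. by rewrite -(scale0r 0) dotZl mul0r. Qed.

Definition dotE := (dotDl, dotDr, dotNl, dotNr, dotZl, dotZr).

Lemma dot_ge0 v : 0 <= dot v v.
Proof. by apply: sumr_ge0 => i _; rewrite -expr2 sqr_ge0. Qed.

Lemma enorm_ge0 v : 0 <= enorm v.
Proof. exact: sqrtr_ge0. Qed.

Lemma sqr_enorm v : enorm v ^+ 2 = dot v v.
Proof. by rewrite sqr_sqrtr ?dot_ge0. Qed.

Lemma ler_coord_enorm v i : `|v ord0 i| <= enorm v.
Proof.
rewrite -sqrtr_sqr ler_sqrt ?dot_ge0// /dot (bigD1 i)//= -expr2 lerDl.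
by apply: sumr_ge0 => j _; rewrite -expr2 sqr_ge0.
Qed.

Lemma enorm_eq0 v : (enorm v == 0) = (v == 0).
Proof.
apply/eqP/eqP => [v0|->]; last by rewrite /enorm dot0l sqrtr0.
apply/rowP => i; apply/eqP; rewrite mxE -normr_le0.
by rewrite (le_trans (ler_coord_enorm v i))// v0.
Qed.

Lemma enorm_gt0 v : (0 < enorm v) = (v != 0).
Proof. by rewrite lt_neqAle enorm_ge0 andbT eq_sym enorm_eq0. Qed.

Lemma enorm0 : enorm (0 : 'rV[R]_N) = 0.
Proof. by apply/eqP; rewrite enorm_eq0. Qed.

Lemma enormZ a v : enorm (a *: v) = `|a| * enorm v.
Proof.
rewrite /enorm dotZl dotZr mulrA -expr2 sqrtrM ?sqr_ge0//.
by rewrite sqrtr_sqr.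
Qed.

Lemma enormN v : enorm (- v) = enorm v.
Proof. by rewrite -scaleN1r enormZ normrN1 mul1r. Qed.

Lemma enormBC v w : enorm (v - w) = enorm (w - v).
Proof. by rewrite -enormN opprB. Qed.

Lemma dot_le v w : dot v w <= enorm v * enorm w.
Proof.
have [->|v0] := eqVneq v 0; first by rewrite dot0l enorm0 mul0r.
have [->|w0] := eqVneq w 0; first by rewrite dotC dot0l enorm0 mulr0.
have v1 : 0 < enorm v by rewrite enorm_gt0.
have w1 : 0 < enorm w by rewrite enorm_gt0.
have := dot_ge0 (enorm w *: v - enorm v *: w).
rewrite !dotE (dotC w v) -!sqr_enorm => h.
have : 0 <= (enorm v * enorm w) * (enorm v * enorm w - dot v w) by lra.
by rewrite pmulr_rge0 ?mulr_gt0// subr_ge0.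
Qed.

Lemma norm_dot_le v w : `|dot v w| <= enorm v * enorm w.
Proof. by rewrite ler_norml dot_le -(enormN v) lerNl -dotNl dot_le. Qed.

Lemma enormD v w : enorm (v + w) <= enorm v + enorm w.
Proof.
rewrite -ler_sqr ?nnegrE ?addr_ge0 ?enorm_ge0// sqr_enorm !dotE (dotC w v).
by rewrite sqrrD -!sqr_enorm; have := dot_le v w; lra.
Qed.

Lemma enormB v w : enorm (v - w) <= enorm v + enorm w.
Proof. by rewrite -(enormN w) enormD. Qed.

Lemma enorm_le v a : (forall p, enorm p = 1 -> dot p v <= a) -> 0 <= a ->
  enorm v <= a.
Proof.
move=> va a0; have [->|v0] := eqVneq v 0; first by rewrite enorm0.
have v1 : 0 < enorm v by rewrite enorm_gt0.
have := va ((enorm v)^-1 *: v); rewrite enormZ dotZl -sqr_enorm expr2.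
by rewrite gtr0_norm ?invr_gt0// mulVf ?gt_eqF// mulKf ?gt_eqF// => ->.
Qed.

Lemma ler_norm_enorm v : `|v| <= enorm v.
Proof.
rewrite [leLHS]/Num.norm/= mx_normrE; apply: bigmax_le => [|[i j] _/=].
  exact: enorm_ge0.
by rewrite ord1 ler_coord_enorm.
Qed.

Lemma ler_enorm_norm v : enorm v <= N%:R * `|v|.
Proof.
have vi i : `|v ord0 i| <= `|v|.
  rewrite [leRHS]/Num.norm/= mx_normrE.
  by apply: (le_trans _ (le_bigmax _ _ (ord0, i))).
apply: enorm_le; last by rewrite mulr_ge0.
move=> p p1; have -> : N%:R * `|v| = \sum_(i < N) `|v|.
  by rewrite sumr_const card_ord mulr_natl.
apply: ler_sum => i _; rewrite (le_trans (ler_norm _))// normrM.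
by rewrite -[leRHS]mul1r ler_pM// -p1 ler_coord_enorm.
Qed.

(** The topology comes from the sup norm, so a Euclidean Lipschitz bound loses a factor [N]; a
    one-sided bound suffices because [v] and [w] can be swapped. *)
Lemma enorm_lipschitz_continuous (f : 'rV[R]_N -> R) C : 0 <= C ->
  (forall v w, f v - f w <= C * enorm (v - w)) -> continuous f.
Proof.
move=> C0 fC v.
apply/(@cvgrPdist_le _ _ _ _ (nbhs_filter (v : 'rV[R]_N))) => e e0.
have d0 : 0 < e / (C * N%:R + 1) by rewrite divr_gt0// ltr_wpDl// mulr_ge0.
apply/nbhs_ballP; exists (e / (C * N%:R + 1)) => //= w.
rewrite -ball_normE/= => /ltW.
rewrite ler_pdivlMr ?ltr_wpDl ?mulr_ge0// => vw.
have {}vw : C * enorm (v - w) <= e.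
  rewrite (le_trans _ vw)// mulrC.
  rewrite (le_trans (ler_wpM2r C0 (ler_enorm_norm _)))// mulrAC mulrC.
  by rewrite ler_wpM2l// mulrC lerDl.
have h1 := fC v w; have h2 := fC w v.
rewrite (enormBC w) in h2.
by rewrite ler_norml; apply/andP; split; lra.
Qed.

Lemma continuous_enorm : continuous (@enorm R N).
Proof.
apply: (@enorm_lipschitz_continuous _ 1) => // v w.
by rewrite mul1r lerBlDr -{1}(subrK w v) enormD.
Qed.

Lemma continuous_dot p : continuous (dot p).
Proof.
apply: (@enorm_lipschitz_continuous _ (enorm p)); first exact: enorm_ge0.
by move=> v w; rewrite -dotBr dot_le.
Qed.

Lemma compact_sphere : compact [set p : 'rV[R]_N | enorm p = 1].
Proof.
apply: bounded_closed_compact.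
  exists 1; split; first exact: num_real.
  move=> a a1 p /= p1.
  by rewrite (le_trans (ler_norm_enorm _))// p1 ltW.
rewrite (_ : mkset _ = @enorm R N @^-1` [set 1])//.
by apply: preimage_closed; [move=> v _; exact: continuous_enorm|exact: closed_eq].
Qed.

Lemma sphere_nonempty : (0 < N)%N -> [set p : 'rV[R]_N | enorm p = 1] !=set0.
Proof.
move=> N0; pose i := Ordinal N0; pose d : 'rV[R]_N := delta_mx ord0 i.
have d0 : enorm d != 0.
  rewrite enorm_eq0; apply/eqP => /rowP/(_ i)/eqP.
  by rewrite !mxE !eqxx oner_eq0.
exists ((enorm d)^-1 *: d) => /=.
by rewrite enormZ normfV ger0_norm ?enorm_ge0// mulVf.
Qed.

End EuclideanSpace.

(** * One-sided estimates of directional derivatives *)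

Section DirectionalDerivative.
Context {R : realType} {V : normedModType R}.

(* The quadratic term is harmless for the derivative; it allows the Euclidean
   norm as a test function. *)
Lemma derive_le (f : V -> R) p v (c K : R) : derivable f p v ->
  (forall s, 0 < s -> f (s *: v + p) - f p <= s * c + s ^+ 2 * K) ->
  'D_v f p <= c.
Proof.
move=> df fc; apply/ler_addgt0Pr => e e0.
have e20 : 0 < e / 2 by rewrite divr_gt0.
have /cvgrPdist_lt/(_ _ e20)[d /= d0 fd] := df.
pose s := Num.min (d / 2) (e / 2 / (`|K| + 1)).
have s0 : 0 < s by rewrite lt_min !divr_gt0// ltr_wpDl.
have := fd s; rewrite /= sub0r normrN gtr0_norm// gt_eqF//.
have sd : s < d by rewrite gt_min ltr_pdivrMr// mulr2n mulrDr mulr1 ltrDl d0.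
move=> /(_ sd isT); rewrite [_ *: _](_ : _ = s^-1 * (f (s *: v + p) - f p))//.
have sK : s * K <= e / 2.
  rewrite (le_trans (ler_norm _))// normrM gtr0_norm//.
  have : s <= e / 2 / (`|K| + 1) by rewrite ge_min lexx orbT.
  rewrite ler_pdivlMr ?ltr_wpDl//; apply: le_trans.
  by rewrite ler_wpM2l ?lerDl// ltW.
have : s^-1 * (f (s *: v + p) - f p) <= c + s * K.
  rewrite ler_pdivrMl// mulrDr mulrA -expr2; exact: fc.
by rewrite ltr_norml => + /andP[_]; rewrite /derive; lra.
Qed.

Lemma derive_ge (f : V -> R) p v (c K : R) : derivable f p v ->
  (forall s, 0 < s -> s * c - s ^+ 2 * K <= f (s *: v + p) - f p) ->
  c <= 'D_v f p.
Proof.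
move=> df fc; rewrite -lerN2 -(deriveN df).
apply: (@derive_le _ _ _ _ K); first exact: derivableN.
by move=> s /fc; rewrite fctE; lra.
Qed.

End DirectionalDerivative.

(** * [H x] as a support function: gradients, velocity set and interior ball *)

Section SupportFunction.
Context {R : realType} {N : nat} (H : 'rV[R]_N -> 'rV[R]_N -> R).
Context (C0 rmin rmax alpha : R).
Hypothesis sa : standing_assumptions H C0 rmin rmax alpha.
Implicit Types (x p q v e : 'rV[R]_N).

Let r0 : 0 < rmin := SA_rmin sa.

Lemma H_ge x p : rmin * enorm p <= H x p.
Proof. by case: (SA_bounds sa x p). Qed.

Lemma H_le x p : H x p <= rmax * enorm p.
Proof. by case: (SA_bounds sa x p). Qed.

Lemma rmax_gt0 : 0 < rmax.
Proof. exact: lt_trans r0 (SA_rmin_rmax sa). Qed.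

Lemma H_gt0 x p : p != 0 -> 0 < H x p.
Proof.
by move=> p0; rewrite (lt_le_trans _ (H_ge x p))// mulr_gt0// enorm_gt0.
Qed.

Lemma H0 x : H x 0 = 0.
Proof.
by apply/eqP; rewrite eq_le; have := H_ge x 0; have := H_le x 0;
  rewrite enorm0 !mulr0 => -> ->.
Qed.

Lemma HZ x p (t : R) : 0 <= t -> H x (t *: p) = t * H x p.
Proof.
rewrite le_eqVlt => /predU1P[<-|t0]; first by rewrite scale0r H0 mul0r.
exact: (SA_homogeneous sa).
Qed.

Lemma HD x p q : H x (p + q) <= H x p + H x q.
Proof.
have h01 : 0 <= 2^-1 :> R by lra.
have h11 : 2^-1 <= 1 :> R by lra.
have : H x (2^-1 *: p + (1 - 2^-1) *: q) <= 2^-1 * H x p + (1 - 2^-1) * H x q.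
  exact: (@SA_convex _ _ _ _ _ _ _ sa x (Itv01 h01 h11) p q (in_setT _) (in_setT _)).
have -> : 1 - 2^-1 = 2^-1 :> R by lra.
by rewrite -scalerDr HZ//; lra.
Qed.

Lemma continuous_H x : continuous (H x).
Proof.
apply: (@enorm_lipschitz_continuous _ _ _ rmax); first exact/ltW/rmax_gt0.
move=> p q; rewrite (le_trans _ (H_le x (p - q)))// lerBlDr.
by rewrite (le_trans _ (HD x _ _))// subrK.
Qed.

Lemma derivable_H x p q : p != 0 -> derivable (H x) p q.
Proof. by move=> /(SA_differentiable sa x) /diff_derivable. Qed.

Lemma derive_grad x p q : p != 0 -> 'D_q (H x) p = dot (grad_p H x p) q.
Proof.
move=> /(SA_differentiable sa x) df; rewrite deriveE// {1}(row_sum_delta q).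
rewrite linear_sum; apply: eq_bigr => i _.
by rewrite linearZ/= mxE deriveE// mulrC.
Qed.

Lemma grad_le x p q : p != 0 -> dot (grad_p H x p) q <= H x q.
Proof.
move=> p0; rewrite -derive_grad//.
apply: (@derive_le _ _ _ _ _ _ 0); first exact: derivable_H.
move=> s s0; rewrite mulr0 addr0 -(HZ _ _ (ltW s0)).
by rewrite lerBlDr HD.
Qed.

(** The directional derivative inherits the lower bound and is linear in [q]; the direction
    [v - grad_p H x p] then gives [|grad_p H x p - v|^2 <= 0]. *)
Lemma grad_eq x p v (K : R) : p != 0 ->
  (forall q s, 0 < s ->
     s * dot v q - s ^+ 2 * (K * dot q q) <= H x (s *: q + p) - H x p) ->
  grad_p H x p = v.
Proof.
move=> p0 vH.
have h q : dot v q <= dot (grad_p H x p) q.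
  rewrite -derive_grad//.
  apply: (@derive_ge _ _ _ _ _ _ (K * dot q q)); first exact: derivable_H.
  by move=> s s0; exact: vH.
apply/eqP; rewrite -subr_eq0 -enorm_eq0 -sqrf_eq0 sqr_enorm.
have := h (- (grad_p H x p - v)); have := dot_ge0 (grad_p H x p - v).
move: (grad_p H x p - v) (dotBl (grad_p H x p) v) => w wE w0.
rewrite !dotNr => h1.
have := wE w => h2; apply/eqP; lra.
Qed.

(** [H x] lies above the linear function [dot v] and touches it at [p], so differentiability leaves
    one candidate for the gradient. Boundary points of the velocity set are recognised as gradients
    in this way. *)
Lemma grad_eq_support x p v : p != 0 ->
  (forall q, dot v q <= H x q) -> dot v p = H x p -> grad_p H x p = v.
Proof.
move=> p0 vH vp; apply: (@grad_eq _ _ _ 0) => // q s s0.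
by rewrite mul0r mulr0 subr0 -dotZr -vp lerBrDr -dotDr vH.
Qed.

(** Euler's identity: along the ray through [p], [H x] grows linearly. *)
Lemma dot_grad x p : p != 0 -> dot (grad_p H x p) p = H x p.
Proof.
move=> p0; apply/eqP; rewrite eq_le grad_le//= -derive_grad//.
apply: (@derive_ge _ _ _ _ _ _ 0); first exact: derivable_H.
move=> s s0; rewrite mulr0 subr0.
have -> : s *: p + p = (s + 1) *: p by rewrite scalerDl scale1r.
by rewrite HZ; lra.
Qed.

(* [s] is the gauge of the convex set with support function [H x] at [v]. *)
Lemma gauge_exists x v : v != 0 -> exists s p, [/\ 0 < s, enorm p = 1,
  forall q, dot v q <= s * H x q & dot v p = s * H x p].
Proof.
move=> v0.
have N0 : (0 < N)%N.
  rewrite lt0n; apply/negP => /eqP N0; move/negP: v0; apply; apply/eqP.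
  by apply/rowP => i; have := ltn_ord i; rewrite {2}N0.
have S0 p : enorm p = 1 -> p != 0 by move=> p1; rewrite -enorm_gt0 p1.
(* The gauge is the maximum of this ratio over the unit sphere, attained at an outer normal [p]. *)
pose f p := dot v p / H x p.
have fS : {within [set p : 'rV[R]_N | enorm p = 1], continuous f}.
  apply: continuous_in_subspaceT => p /[1!inE]/= /S0 p0.
  have Fp := nbhs_filter (p : 'rV[R]_N).
  apply: (@cvgM _ _ _ Fp); first exact: continuous_dot.
  by apply: (@cvgV _ _ _ Fp); [rewrite gt_eqF// H_gt0|exact: continuous_H].
have [p] := compact_EVT_max (sphere_nonempty N0) compact_sphere fS.
rewrite inE/= => p1 pmax; exists (f p), p.
have pmax' q : dot v q <= f p * H x q.
  have [->|q0] := eqVneq q 0; first by rewrite dotC dot0l H0 mulr0.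
  have q1 : 0 < enorm q by rewrite enorm_gt0.
  have := pmax ((enorm q)^-1 *: q); rewrite inE/= enormZ gtr0_norm ?invr_gt0//.
  rewrite mulVf ?gt_eqF// => /(_ erefl).
  rewrite {1}/f dotZr HZ ?invr_ge0 ?enorm_ge0// invfM mulrACA mulfV ?mul1r; last first.
    by rewrite invr_neq0// gt_eqF.
  by rewrite ler_pdivrMr// H_gt0.
split => //.
- have := pmax' v; rewrite -sqr_enorm => vf.
  have : 0 < f p * H x v by rewrite (lt_le_trans _ vf)// exprn_gt0// enorm_gt0.
  by rewrite pmulr_lgt0// H_gt0.
- by rewrite mulfVK// gt_eqF// H_gt0// S0.
Qed.

(** The half-space cut out by [p] is convex and contains every gradient by [grad_le], hence also
    their convex hull. *)
Lemma velocity_set_le x v p : velocity_set H x v -> dot v p <= H x p.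
Proof.
move: v; apply: smallest_sub => [v w t|_ [q /= q0 <-]]; last first.
  exact: grad_le.
rewrite !inE/= => vp wp.
change (dot (t%:num *: v + (1 - t%:num) *: w) p <= H x p); rewrite !dotE.
have t0 : 0 <= t%:num by [].
have t1 : t%:num <= 1 by [].
have := ler_wpM2l t0 vp; have := @ler_wpM2l _ (1 - t%:num) _ _ _ wp.
by rewrite subr_ge0 => /(_ t1); lra.
Qed.

(** The line through the origin and [v] leaves the set with support function [H x] at two points;
    both are gradients by [grad_eq_support], and [v] lies between them. *)
Lemma le_velocity_set x v : (0 < N)%N ->
  (forall p, dot v p <= H x p) -> velocity_set H x v.
Proof.
move=> N0 vH.
have boundary_pt e : e != 0 -> exists s, [/\ 0 < s,
    forall q, dot e q <= s * H x q, exists2 p, p != 0 & dot e p = s * H x p &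
    [set grad_p H x p | p in [set p | p != 0]] (s^-1 *: e)].
  move=> /(gauge_exists x)[s [p [s0 p1 se sp]]]; exists s.
  have p0 : p != 0 by rewrite -enorm_gt0 p1.
  split=> //; first by exists p.
  exists p => //=; apply: grad_eq_support => // [q|]; rewrite dotZl.
    by rewrite ler_pdivrMl.
  by rewrite sp mulKf ?gt_eqF.
have [e [a [e0 a01 vE]]] : exists e a, [/\ e != 0, a = 0 \/ a = 1 & v = a *: e].
  have [->|v0] := eqVneq v 0; last by exists v, 1; split; [|right|rewrite scale1r].
  have [e e1] := @sphere_nonempty R N N0; exists e, 0.
  by split; [rewrite -enorm_gt0 e1|left|rewrite scale0r].
have [s [s0 se [p p0 sp] gs]] := boundary_pt e e0.
have [|s' [s'0 _ _ gs']] := boundary_pt (- e); first by rewrite oppr_eq0.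
have as1 : a * s <= 1.
  have := vH p; rewrite vE dotZl sp mulrA.
  by rewrite -[leRHS]mul1r ler_pM2r ?H_gt0.
have a0 : 0 <= a by case: a01 => ->.
(* The solution of [l / s - (1 - l) / s' = a]; the inequality [a * s <= 1] is what makes
   [l <= 1]. *)
pose l := s * (a * s' + 1) / (s + s').
have ss'0 : 0 < s + s' by rewrite addr_gt0.
have as'0 : 0 <= a * s' by rewrite mulr_ge0// ltW.
have l0 : 0 <= l.
  by rewrite divr_ge0//; [rewrite mulr_ge0 ?addr_ge0// ltW|exact: ltW].
have l1 : l <= 1.
  rewrite ler_pdivrMr// mul1r mulrDr mulr1 addrC lerD2l mulrA (mulrC s).
  by rewrite -[leRHS]mul1r ler_wpM2r// ltW.
move=> A [Aconv Agrad].
suff -> : v = l *: (s^-1 *: e) + (1 - l) *: (s'^-1 *: - e).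
  apply: set_mem.
  exact: (Aconv _ _ (Itv01 l0 l1) (mem_set (Agrad _ gs)) (mem_set (Agrad _ gs'))).
rewrite vE !scalerN !scalerA -scaleNr -scalerDl; congr (_ *: _).
by rewrite /l; field; rewrite !gt_eqF.
Qed.

(** Let [D] be the signed distance from [c = grad_p H x p - rmin p] to the boundary of the velocity
    set, reached in direction [m]. The gradient at [m] is [c + D m], and comparing it with the
    gradient at [p] forces [D >= rmin]. *)
Lemma interior_ball x p q : enorm p = 1 -> enorm q = 1 ->
  dot (grad_p H x p) q + rmin * (1 - dot p q) <= H x q.
Proof.
have S0 (w : 'rV[R]_N) : enorm w = 1 -> w != 0 by move=> w1; rewrite -enorm_gt0 w1.
move=> p1 q1; pose c := grad_p H x p - rmin *: p.
pose f w := H x w - dot c w.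
have fS : {within [set p : 'rV[R]_N | enorm p = 1], continuous f}.
  apply: continuous_subspaceT => w.
  have Fw := nbhs_filter (w : 'rV[R]_N).
  by apply: (@cvgB _ _ _ _ Fw); [exact: continuous_H|exact: continuous_dot].
have [|m] := compact_EVT_min _ compact_sphere fS; first by exists p.
rewrite inE/= => m1 mmin; pose D := f m.
have HD' w : D * enorm w + dot c w <= H x w.
  have [->|w0] := eqVneq w 0; first by rewrite enorm0 H0 dotC dot0l mulr0 addr0.
  have w1 : 0 < enorm w by rewrite enorm_gt0.
  have := mmin ((enorm w)^-1 *: w); rewrite inE/= enormZ gtr0_norm ?invr_gt0//.
  rewrite mulVf ?gt_eqF// => /(_ erefl).
  rewrite {2}/f dotZr HZ ?invr_ge0 ?enorm_ge0// -mulrBr -/D.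
  by rewrite ler_pdivlMl// (mulrC _ D); lra.
(* [H x] stays above [D |w| + dot c w] and touches it at [m]; the second-order expansion of the norm
   at a unit vector makes [grad_eq] applicable. At this stage [D] may be negative, hence [|D|]. *)
have gm : grad_p H x m = c + D *: m.
  apply: (@grad_eq _ _ _ (`|D| / 2)); first exact: S0.
  move=> w s s0; have := HD' (s *: w + m).
  have Hm : H x m = D + dot c m by rewrite /D /f subrK.
  rewrite Hm !dotE.
  have : - (s ^+ 2 * (`|D| / 2 * dot w w)) <=
      D * (enorm (s *: w + m) - 1 - s * dot m w).
    have : `|enorm (s *: w + m) - 1 - s * dot m w| <= s ^+ 2 * dot w w / 2.
      have sq : enorm (s *: w + m) ^+ 2 = 1 + 2 * s * dot m w + s ^+ 2 * dot w w.
        by rewrite sqr_enorm !dotE (dotC w m) -!sqr_enorm m1; ring.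
      have y0 := enorm_ge0 (s *: w + m).
      have := dot_le m (s *: w + m); rewrite m1 !dotE -sqr_enorm m1.
      have ww := dot_ge0 w.
      move: (enorm (s *: w + m)) sq y0 => y sq y0 h.
      have h2 : 0 <= (y - 1) ^+ 2 by rewrite sqr_ge0.
      have ? : 0 <= s ^+ 2 * dot w w by rewrite mulr_ge0// sqr_ge0.
      rewrite ger0_norm; lra.
    move=> h; have := ler_wpM2l (normr_ge0 D) h; rewrite -normrM => {}h.
    have := ler_norm (- (D * (enorm (s *: w + m) - 1 - s * dot m w))).
    rewrite normrN; lra.
  lra.
suff rD : rmin <= D.
  have := HD' q; rewrite q1 mulr1 dotBl dotZl; lra.
rewrite leNgt; apply/negP => Dr.
(* For the difference [D m - rmin p] the cross terms cancel and the left inequality becomes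
   [rmin^2 <= D^2]. *)
have := @SA_grad_bounds _ _ _ _ _ _ _ sa x p m (S0 p p1) (S0 m m1).
rewrite gm p1 invr1 scale1r /c.
have -> : grad_p H x p - rmin *: p + D *: m - grad_p H x p = D *: m - rmin *: p.
  by rewrite addrAC [X in X + _ = _]addrAC subrr sub0r addrC.
have p2 : dot p p = 1 by rewrite -sqr_enorm p1 expr1n.
have m2 : dot m m = 1 by rewrite -sqr_enorm m1 expr1n.
move=> [+ _]; rewrite sqr_enorm !dotE p2 m2 (dotC m p) => h.
have {}h : rmin ^+ 2 <= D ^+ 2.
  have r20 : 0 <= 2 * rmin by rewrite mulr_ge0// ltW.
  have := ler_wpM2l r20 h; rewrite mulrA mulrN div1r divff ?mulN1r; last first.
    by rewrite mulf_neq0// gt_eqF.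
  lra.
(* This remaining case forces [m = - p] and [H x p + H x (- p) <= 0], against positivity. *)
have DN : D <= - rmin.
  move: h; rewrite -subr_ge0 subr_sqr.
  have [//|h] := lerP D (- rmin).
  by rewrite nmulr_rge0 ?subr_lt0//; lra.
have D1 : D = H x m - dot (grad_p H x p) m + rmin * dot p m.
  by rewrite /D /f /c dotBl dotZl; ring.
have pm : -1 <= dot p m.
  by have := norm_dot_le p m; rewrite p1 m1 mulr1 ler_norml => /andP[].
have hm : dot (grad_p H x p) m <= H x m by apply: grad_le; exact: S0.
have rpm := ler_wpM2l (ltW r0) pm.
have pm1 : dot p m = -1.
  apply/eqP; rewrite eq_le pm andbT -(ler_pM2l r0); lra.
have mp : m = - p.
  apply/eqP; rewrite -subr_eq0 opprK -enorm_eq0 -sqrf_eq0 sqr_enorm !dotE.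
  by rewrite p2 m2 (dotC m p) pm1; apply/eqP; ring.
have := H_gt0 x (S0 _ m1); have := H_gt0 x (S0 _ p1).
by rewrite mp dotNr dot_grad ?S0// in D1 *; rewrite dotNr p2 in D1; lra.
Qed.

End SupportFunction.

(** * Second differences of the gauge *)

Section GaugeCurvature.
Context {R : realType} {N : nat} (H : 'rV[R]_N -> 'rV[R]_N -> R).
Context (C0 rmin rmax alpha : R).
Hypothesis sa : standing_assumptions H C0 rmin rmax alpha.
Implicit Types (x p q v e : 'rV[R]_N) (s : R).

Let r0 : 0 < rmin := SA_rmin sa.
Let R0 : 0 < rmax := rmax_gt0 sa.

(** The squared base is the coefficient [rho] of the first-order error in [gauge_perturb]; with this
    value a quadratic form there is a perfect square. *)
Definition gauge_curvature : R := (2 * rmax / rmin + 1) ^+ 2 / rmin ^+ 2.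

Lemma support_le_sphere x v s :
  (forall q, enorm q = 1 -> dot v q <= s * H x q) ->
  forall q, dot v q <= s * H x q.
Proof.
move=> vs q; have [->|q0] := eqVneq q 0.
  by rewrite dotC dot0l (H0 sa) mulr0.
have q1 : 0 < enorm q by rewrite enorm_gt0.
have := vs ((enorm q)^-1 *: q); rewrite enormZ gtr0_norm ?invr_gt0//.
rewrite mulVf ?gt_eqF// => /(_ erefl).
by rewrite dotZr (HZ sa) ?invr_ge0 ?enorm_ge0// mulrCA ler_pM2l ?invr_gt0.
Qed.

Lemma enorm_grad_le x p : p != 0 -> enorm (grad_p H x p) <= rmax.
Proof.
move=> p0; apply: enorm_le; last exact: ltW.
move=> q q1; rewrite dotC (le_trans (grad_le sa x q p0))//.
by rewrite (le_trans (H_le sa x q))// q1 mulr1.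
Qed.

(* Since the ball of radius [rmin] inside the convex set touches its boundary
   at [grad_p H x p], the gauge has an upper paraboloid there. *)
Lemma gauge_perturb x p e s : enorm p = 1 -> 0 < s ->
  gauge_curvature * rmin * enorm e <= s ->
  forall q, dot (s *: grad_p H x p + e) q <=
    (s + dot e p / H x p + gauge_curvature * enorm e ^+ 2 / s) * H x q.
Proof.
move=> p1 s0 es; apply: support_le_sphere => q q1.
have p0 : p != 0 by rewrite -enorm_gt0 p1.
set k := gauge_curvature in es *; set v := grad_p H x p; set E := enorm e.
set rho := 2 * rmax / rmin + 1.
have rr : rmin < rmax := SA_rmin_rmax sa.
have kE : k * rmin ^+ 2 = rho ^+ 2.
  by rewrite /k /gauge_curvature mulfVK// expf_neq0// gt_eqF.
have E0 : 0 <= E := enorm_ge0 e.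
have rho3 : 3 <= rho.
  have : 1 <= rmax / rmin by rewrite ler_pdivlMr// mul1r ltW.
  rewrite /rho; lra.
have h0 : 0 < H x p := H_gt0 sa x p0.
have hr : rmin <= H x p by have := H_ge sa x p; rewrite p1 mulr1.
set h := H x p in h0 hr *; set a := dot e p.
have aE : `|a| <= E by have := norm_dot_le e p; rewrite p1 mulr1.
(* The claimed increment of the gauge: its derivative in direction [e] plus the quadratic error. *)
set d := a / h + k * E ^+ 2 / s.
have k0 : 0 < k by apply: divr_gt0; rewrite exprn_gt0// (lt_le_trans _ rho3).
have ahE : `|a / h| <= E / rmin.
  rewrite normrM normfV (gtr0_norm h0) ler_pdivrMr//.
  rewrite (le_trans aE)//.
  rewrite -mulrA -[leLHS]mulr1 ler_wpM2l//.
  by rewrite ler_pdivlMl// mulr1.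
have kEs0 : 0 <= k * E ^+ 2 / s.
  exact: (divr_ge0 (mulr_ge0 (ltW k0) (sqr_ge0 E)) (ltW s0)).
have kEs : k * E ^+ 2 / s <= E / rmin.
  rewrite ler_pdivrMr// [leRHS]mulrAC ler_pdivlMr//.
  have := ler_wpM2l E0 es; rewrite -/E; lra.
have dE : `|d| <= 2 * E / rmin.
  rewrite (le_trans (ler_normD _ _))// (ger0_norm kEs0); lra.
have Es : 4 * (E / rmin) <= s.
  apply: le_trans es; rewrite mulrA ler_pdivrMr//.
  have -> : k * rmin * E * rmin = k * rmin ^+ 2 * E by ring.
  rewrite kE ler_wpM2r//; have : 3 * 3 <= rho ^+ 2 by rewrite expr2 ler_pM//; lra.
  lra.
have sd : s / 2 <= s + d by have := ler_norm (- d); rewrite normrN; lra.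
have ball := interior_ball sa x p1 q1; rewrite -/v in ball.
rewrite -addrA -/d dotDl dotZl.
set n := enorm (q - p).
have n0 : 0 <= n := enorm_ge0 _.
have nE : n ^+ 2 = 2 - 2 * dot p q.
  rewrite sqr_enorm dotBl !dotBr -!sqr_enorm p1 q1 (dotC q p); ring.
have vq : `|d * dot v (q - p)| <= 2 * E / rmin * (rmax * n).
  rewrite normrM ler_pM// (le_trans (norm_dot_le _ _))//.
  by rewrite ler_wpM2r// enorm_grad_le.
have eq : dot e (q - p) <= E * n := dot_le _ _.
have vp : dot v p = h := dot_grad sa x p0.
have dh : a + k * E ^+ 2 / s * rmin <= d * h.
  by rewrite /d mulrDl divfK ?gt_eqF// lerD2l ler_wpM2l.
(* In [n = |q - p|] the linear errors total [rho E n], while the interior ball supplies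
   [s rmin n^2 / 4]; completing the square fixes [k]. *)
have key : 0 <= k * E ^+ 2 / s * rmin - rho * E * n + s / 4 * rmin * n ^+ 2.
  have -> : k * E ^+ 2 / s * rmin - rho * E * n + s / 4 * rmin * n ^+ 2 =
      (rho * E - s * rmin * n / 2) ^+ 2 / (s * rmin).
    rewrite -[k](@mulfK _ (rmin ^+ 2)) ?expf_neq0 ?gt_eqF// kE.
    by field; rewrite !gt_eqF.
  exact: (divr_ge0 (sqr_ge0 _) (mulr_ge0 (ltW s0) (ltW r0))).
have sdn : s / 4 * rmin * n ^+ 2 <= (s + d) * (rmin * (1 - dot p q)).
  have := @ler_wpM2r _ (rmin * n ^+ 2 / 2) _ _ _ sd.
  have -> : 0 <= rmin * n ^+ 2 / 2 by rewrite divr_ge0// mulr_ge0 ?sqr_ge0// ltW.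
  move=> /(_ isT); rewrite nE; lra.
have rhoE : rho * E * n = 2 * E / rmin * (rmax * n) + E * n.
  by rewrite /rho; ring.
have bs : (s + d) * (dot v q + rmin * (1 - dot p q)) <= (s + d) * H x q.
  by rewrite ler_wpM2l//; lra.
have := ler_norm (- (d * dot v (q - p))); rewrite normrN.
rewrite dotBr vp in vq *; rewrite dotBr -/a in eq; lra.
Qed.

(** [sg] plays the role of the derivative of the gauge along [e] and cancels in sums. Since [s] only
    bounds the gauge [s1] of [v] from above, [gauge_perturb] is used when [s1 > s / 2]; otherwise
    the slack [s / 2] absorbs the perturbation. *)
Lemma gauge_semiconcave x v e s : 0 < s ->
  (forall q, dot v q <= s * H x q) ->
  2 * gauge_curvature * rmin * enorm e <= s ->
  exists2 sg, `|sg| <= s / 2 &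
    (forall q, dot (v + e) q <=
      (s + sg + 2 * gauge_curvature * enorm e ^+ 2 / s) * H x q) /\
    (forall q, dot (v - e) q <=
      (s - sg + 2 * gauge_curvature * enorm e ^+ 2 / s) * H x q).
Proof.
move=> s0 vs es; set k := gauge_curvature in es *; set E := enorm e in es *.
have rr : rmin < rmax := SA_rmin_rmax sa.
have E0 : 0 <= E := enorm_ge0 e.
have kr : 9 <= k * rmin ^+ 2.
  rewrite /k /gauge_curvature mulfVK ?expf_neq0 ?gt_eqF//.
  have : 1 <= rmax / rmin by rewrite ler_pdivlMr// mul1r ltW.
  move=> h; have : 3 * 3 <= (2 * rmax / rmin + 1) ^+ 2 by rewrite expr2 ler_pM//; lra.
  lra.
have k0 : 0 < k.
  have r20 : 0 < rmin ^+ 2 by rewrite exprn_gt0.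
  by rewrite -(pmulr_lgt0 _ r20); lra.
have Hp q : 0 <= H x q.
  by rewrite (le_trans _ (H_ge sa x q))// mulr_ge0 ?enorm_ge0// ltW.
have Es : E / rmin <= s / 2.
  rewrite ler_pdivrMr//; have := @ler_wpM2l _ rmin (ltW r0) _ _ es.
  have := ler_wpM2r E0 kr; lra.
have kEs0 : 0 <= 2 * k * E ^+ 2 / s.
  have -> : 2 * k * E ^+ 2 / s = 2 * (k * E ^+ 2 / s) by rewrite !mulrA.
  rewrite mulr_ge0//.
  exact: (divr_ge0 (mulr_ge0 (ltW k0) (sqr_ge0 E)) (ltW s0)).
have eH w q : enorm w = E -> dot w q <= E / rmin * H x q.
  move=> wE; rewrite (le_trans (dot_le _ _))// wE -mulrA ler_wpM2l//.
  by rewrite ler_pdivlMl// (H_ge sa).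
have small s1 : s1 <= s / 2 -> (forall q, dot v q <= s1 * H x q) ->
  forall w q, enorm w = E ->
    dot (v + w) q <= (s + 0 + 2 * k * E ^+ 2 / s) * H x q.
  move=> s1s vs1 w q wE; rewrite dotDl.
  rewrite (le_trans (lerD (vs1 q) (eH w q wE)))// -mulrDl ler_wpM2r//; lra.
have small' s1 : s1 <= s / 2 -> (forall q, dot v q <= s1 * H x q) ->
  exists2 sg, `|sg| <= s / 2 &
    (forall q, dot (v + e) q <= (s + sg + 2 * k * E ^+ 2 / s) * H x q) /\
    (forall q, dot (v - e) q <= (s - sg + 2 * k * E ^+ 2 / s) * H x q).
  move=> s1s vs1; exists 0; first by rewrite normr0 divr_ge0// ltW.
  split=> q; first exact: (small s1).
  have := small s1 s1s vs1 (- e) q (enormN e).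
  by rewrite addr0 subr0.
have [v0|v0] := eqVneq v 0.
  by apply: (small' 0) => [|q]; [rewrite divr_ge0// ltW|rewrite v0 dot0l mul0r].
have [s1 [p [s10 p1 vs1 vp]]] := gauge_exists sa x v0.
have p0 : p != 0 by rewrite -enorm_gt0 p1.
have h0 : 0 < H x p := H_gt0 sa x p0.
have [/small'|ss1] := lerP s1 (s / 2); first exact.
have s1s : s1 <= s by rewrite -(ler_pM2r h0) -vp.
have vE : v = s1 *: grad_p H x p.
  rewrite (@grad_eq_support _ _ _ _ _ _ _ sa x p (s1^-1 *: v))//.
  - by rewrite scalerA mulfV ?gt_eqF// scale1r.
  - by move=> q; rewrite dotZl ler_pdivrMl.
  - by rewrite dotZl vp mulKf ?gt_eqF.
(* The factor 2 in the statement pays for replacing [s1] by [s < 2 s1]. *)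
have ks : k * E ^+ 2 / s1 <= 2 * k * E ^+ 2 / s.
  rewrite ler_pdivrMr// [leRHS]mulrAC ler_pdivlMr//.
  have := @ler_wpM2l _ (k * E ^+ 2) _ _ _ (ltW ss1).
  have -> : 0 <= k * E ^+ 2 by rewrite mulr_ge0 ?sqr_ge0// ltW.
  by move=> /(_ isT); lra.
have es1 : k * rmin * E <= s1 by lra.
have aE w : enorm w = E -> `|dot w p / H x p| <= s / 2.
  move=> wE; rewrite (le_trans _ Es)// normrM normfV (gtr0_norm h0).
  rewrite ler_pdivrMr// (le_trans (norm_dot_le _ _))// wE -mulrA ler_wpM2l//.
  by rewrite ler_pdivlMl// (H_ge sa).
exists (dot e p / H x p); first exact: aE.
split=> q; rewrite vE.
  rewrite (le_trans (gauge_perturb x p1 s10 es1 q))// ler_wpM2r// -/k -/E; lra.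
rewrite /E -enormN in es1.
rewrite (le_trans (gauge_perturb x p1 s10 es1 q))// ler_wpM2r// enormN dotNl -/k -/E.
lra.
Qed.

End GaugeCurvature.

(** * Growth of absolutely continuous arcs with derivative bounded almost everywhere *)

Section AbsolutelyContinuous.
Context {R : realType} {N : nat}.
Implicit Types (X : R -> 'rV[R]_N) (p : 'rV[R]_N) (s t : R) (L : seq (R * R)).

(* Stacks of intervals inside [U], listed from right to left, which start after
   [a] and end before [s]. *)
Fixpoint interval_stack (U : set R) (a s : R) L : Prop :=
  if L is i :: L' then
    [/\ i.1 <= i.2, i.2 <= s, `]i.1, i.2[ `<=` U & interval_stack U a i.1 L']
  else a <= s.

Lemma interval_stackW U a s s' L : s <= s' ->
  interval_stack U a s L -> interval_stack U a s' L.
Proof.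
case: L => [|i L] ss' /=; first by move=> /le_trans; exact.
by case=> ? /le_trans/(_ ss').
Qed.

Lemma interval_stack_nth U a s L i : interval_stack U a s L -> (i < size L)%N ->
  let I := nth (0, 0) L i in
  [/\ a <= I.1, I.1 <= I.2, I.2 <= s & `]I.1, I.2[ `<=` U].
Proof.
elim: L s i => // -[x y] L IH s [|i] /= [xy ys xyU sL] iL; last first.
  have [? ? yx ?] := IH _ _ sL iL.
  by split=> //; rewrite (le_trans yx)// (le_trans xy).
split=> //; case: L sL {IH iL} => // -[x' y'] L /= [x'y' y'x _].
elim: L x' y' x y x'y' y'x {xy ys xyU} => [|[x1 y1] L IH] x' y' x y x'y' y'x /=.
  by move=> ax'; rewrite (le_trans ax')// (le_trans x'y').
move=> [x1y1 y1x' _ sL]; rewrite (le_trans _ (le_trans x'y' y'x))//.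
exact: (IH x1 y1 x' y').
Qed.

Lemma interval_stack_disjoint U a s L i j : interval_stack U a s L ->
  (i < j)%N -> (j < size L)%N -> (nth (0, 0) L j).2 <= (nth (0, 0) L i).1.
Proof.
elim: L s i j => // -[x y] L IH s [|i] [|j]//= [xy ys xyU sL] ij jL.
  by have [] := interval_stack_nth sL jL.
exact: (IH _ _ _ sL).
Qed.

(** The intervals are disjoint and lie in [U], so their lengths add up to at most its measure. Both
    conclusions have the form that [abs_continuous] asks of a family. *)
Lemma interval_stack_measure U a s L (d : R) : open U ->
  (lebesgue_measure U < d%:E)%E -> interval_stack U a s L ->
  trivIset [set: 'I_(size L)]
    (fun i => `](nth (0, 0) L i).1, (nth (0, 0) L i).2[%classic) /\
  \sum_(i < size L) ((nth (0, 0) L i).2 - (nth (0, 0) L i).1) < d.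
Proof.
move=> oU Ud sL.
pose F (i : 'I_(size L)) : set R :=
  `](nth (0, 0) L i).1, (nth (0, 0) L i).2[%classic.
have tI : trivIset [set: 'I_(size L)] F.
  apply/trivIsetP => i j _ _ ij; apply/seteqP; split=> // z [].
  rewrite /F/= !in_itv/= => /andP[z1 z2] /andP[z3 z4].
  have [lt_ij|lt_ji|/val_inj eq_ij] := ltngtP (val i) (val j).
  - have := interval_stack_disjoint sL lt_ij (ltn_ord j).
    by move=> /(le_lt_trans) h; have := lt_trans z4 (h _ z1); rewrite ltxx.
  - have := interval_stack_disjoint sL lt_ji (ltn_ord i).
    by move=> /(le_lt_trans) h; have := lt_trans z2 (h _ z3); rewrite ltxx.
  - by rewrite eq_ij eqxx in ij.
split=> //; rewrite -lte_fin; apply: le_lt_trans Ud.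
have mI i : measurable (F i) by exact: measurable_itv.
rewrite (_ : _%:E = \sum_(i < size L) lebesgue_measure (F i))%E.
  have mF : measurable (\big[setU/set0]_(i < size L) F i).
    by apply: bigsetU_measurable => i _; exact: mI.
  have <- := @measure_semi_additive_ord _ _ _ (@lebesgue_measure R) _ F mI tI mF.
  apply: le_measure; rewrite ?inE.
  - exact: mF.
  - exact: measurable_realfun.open_measurable.
  - apply: (big_ind (fun A => A `<=` U)) => // [A B AU BU z|i _].
      by case=> [/AU|/BU].
    by have [] := interval_stack_nth sL (ltn_ord i).
rewrite -sumEFin; apply: eq_bigr => i _.
have [_ h _ _] := interval_stack_nth sL (ltn_ord i).
rewrite /F lebesgue_measure_itv/= lte_fin; case: ltP => // h'.
have -> : (nth (0, 0) L i).1 = (nth (0, 0) L i).2 by apply/le_anti/andP.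
by rewrite subrr.
Qed.

(* Cousin-type argument: the set of [s] up to which the increment is controlled
   by the length and a stack of intervals of [U] is closed and open. *)
Lemma increment_le_stack (U : set R) (f : R -> R) (a b c K : R) :
  a <= b -> open U -> - c <= K ->
  (forall m, a <= m <= b -> ~ U m ->
     \forall h \near 0^', h^-1 * (f (h + m) - f m) <= c) ->
  exists2 L, interval_stack U a b L & f b - f a <= c * (b - a) +
    \sum_(i <- L) (`|f i.2 - f i.1| + K * (i.2 - i.1)).
Proof.
move=> ab oU cK fc.
pose P s := exists2 L, interval_stack U a s L & f s - f a <= c * (s - a) +
    \sum_(i <- L) (`|f i.2 - f i.1| + K * (i.2 - i.1)).
(* Near any [m], [P] passes from [s <= m] to [t >= m]: in [U] the interval from [s] to [t] is pushed
   on the stack, where [- c <= K] covers a negative [c]; off [U] the difference quotients on both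
   sides of [m] are at most [c]. *)
have step m : a <= m <= b -> exists2 d, 0 < d & forall s t,
    m - d < s -> s <= m -> m <= t -> t < m + d -> P s -> P t.
  move=> mab; have [Um|nUm] := pselect (U m).
    have /nbhs_ballP[d /= d0 dU] := open_nbhs_nbhs (conj oU Um).
    exists d => // s t ms sm mt td [L sL sf].
    exists ((s, t) :: L).
      split=> //=; first exact: le_trans mt.
      move=> z /=; rewrite in_itv/= => /andP[sz zt]; apply: dU.
      by rewrite -ball_normE/= ltr_norml; apply/andP; split; lra.
    rewrite big_cons/=; have := ler_norm (f t - f s).
    have : 0 <= (c + K) * (t - s) by rewrite mulr_ge0; lra.
    lra.
  have [d /= d0 fd] := fc m mab nUm.
  exists d => // s t ms sm mt td [L sL sf].
  exists L; first exact: interval_stackW (le_trans sm mt) sL.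
  have ft : f t - f m <= c * (t - m).
    move: mt; rewrite le_eqVlt => /predU1P[->|mt]; first by rewrite !subrr mulr0.
    have tm : 0 < t - m by rewrite subr_gt0.
    have := fd (t - m); rewrite /= sub0r normrN gtr0_norm// gt_eqF//.
    by rewrite subrK ler_pdivrMl// mulrC; apply; rewrite // ltrBlDl.
  have fs : f m - f s <= c * (m - s).
    move: sm; rewrite le_eqVlt => /predU1P[->|sm]; first by rewrite !subrr mulr0.
    have tm : 0 < m - s by rewrite subr_gt0.
    have := fd (s - m); rewrite /= sub0r normrN distrC gtr0_norm//.
    rewrite subr_eq0 lt_eqF// subrK -(opprB m) -(opprB (f m)) invrN mulrNN.
    by rewrite ler_pdivrMl// mulrC; apply; rewrite //; lra.
  lra.
pose S := [set s | a <= s <= b /\ P s].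
have Sa : S a.
  split; first by rewrite lexx.
  by exists [::]; rewrite /= ?big_nil; lra.
have bS : has_ubound S by exists b => s [/andP[]].
have hS : has_sup S by split=> //; exists a.
have am : a <= sup S := ub_le_sup bS Sa.
have mb : sup S <= b by apply: ge_sup; [exists a|move=> s [/andP[]]].
have [d d0 md] := step (sup S) (introT andP (conj am mb)).
have [s [/andP[sa sb] Ps] ms] := sup_adherent d0 hS.
have sm : s <= sup S by apply: (ub_le_sup bS); split=> //; apply/andP.
(* This lies beyond the supremum unless [b] comes first, so [P t] forces [t = b]. *)
pose t := Num.min b (sup S + d / 2).
have mt : sup S <= t by rewrite le_min mb lerDl divr_ge0// ltW.
have td : t < sup S + d by rewrite gt_min; apply/orP; right; lra.
have Pt : P t by apply: md Ps.
have : t <= sup S.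
  apply: (ub_le_sup bS); split=> //; rewrite (le_trans am mt)/=.
  by rewrite ge_min lexx.
rewrite ge_min => /orP[bm|]; last by lra.
have tb : t = b by apply/min_idPl; lra.
by rewrite tb in Pt.
Qed.

(** The exceptional null set is covered by an open [U] of small measure. Off [U] the derivative
    controls the growth; the stacked intervals inside [U] have small total length, so absolute
    continuity makes their increments small. *)
Lemma ac_increment_le X p (T c : R) : 0 <= T -> enorm p = 1 ->
  abs_continuous 0 T X ->
  {ae @lebesgue_measure R, forall t, 0 <= t <= T ->
     derivable X t 1 /\ dot p (derive1 X t) <= c} ->
  dot p (X T) - dot p (X 0) <= c * T.
Proof.
move=> T0 p1 acX [A [mA A0 AX]]; apply/ler_addgt0Pr => e0 e00.
(* The total error is [e T + e + (|c| + e) e], at most [e0] for this choice. *)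
pose e := Num.min 1 (e0 / (T + `|c| + 2)).
have Tc : 0 < T + `|c| + 2 by have := normr_ge0 c; lra.
have e_gt0 : 0 < e by rewrite lt_min ltr01 divr_gt0.
have e_le1 : e <= 1 by rewrite ge_min lexx.
have eTc : e * (T + `|c| + 2) <= e0.
  by rewrite -ler_pdivlMr// ge_min lexx orbT.
have [d d0 Xd] := acX e e_gt0.
have de0 : 0 < Num.min d e by rewrite lt_min d0.
have Aoo : (lebesgue_measure A < +oo)%E by rewrite A0.
have [U [oU AU Ud]] := lebesgue_regularity_outer mA Aoo de0.
have {}Ud : (lebesgue_measure U < (Num.min d e)%:E)%E.
  rewrite (le_lt_trans _ Ud)//.
  have mUA : measurable (U `\` A).
    by apply: measurableD => //; exact: measurable_realfun.open_measurable.
  rewrite -[leRHS]add0e -A0 (le_trans _ (measureU2 _ mA mUA))// le_measure ?inE//.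
  - exact: measurable_realfun.open_measurable.
  - exact: measurableU.
  - by move=> z Uz; have [Az|nAz] := pselect (A z); [left|right].
have [|m /andP[m0 mT] nUm|L sL XL] :=
    @increment_le_stack U (fun t => dot p (X t)) 0 T (c + e) (`|c| + e) T0 oU.
- by have := ler_norm (- c); rewrite normrN; lra.
- have [dX Xc] : derivable X m 1 /\ dot p (derive1 X m) <= c.
    apply: contrapT => nX; apply: nUm; apply: AU; apply: AX => /=.
    by rewrite m0 mT => /(_ isT).
  have {}dX : h^-1 *: ((X \o shift m) (h *: 1) - X m) @[h --> 0^'] --> derive1 X m.
    by rewrite derive1E; exact: dX.
  have /cvgrPdist_le/(_ _ e_gt0) := cvg_comp _ _ dX (@continuous_dot R N p _).
  move=> Xe; apply: (filterS (F := 0^') _ Xe) => h /=; rewrite ler_norml => /andP[+ _].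
  rewrite dotZr dotBr [h%:A]mulr1; lra.
have [tL sumL] := interval_stack_measure oU Ud sL.
have XLe : \sum_(i <- L) `|dot p (X i.2) - dot p (X i.1)| <= e.
  apply: le_trans (ltW (Xd _ _ _ _ tL _)); last 2 first.
  - by move=> i; have [] := interval_stack_nth sL (ltn_ord i).
  - by rewrite (lt_le_trans sumL)// ge_min lexx.
  rewrite (big_nth (0, 0)) big_mkord ler_sum// => i _.
  by rewrite -dotBr (le_trans (norm_dot_le _ _))// p1 mul1r.
have KLe : \sum_(i <- L) (`|c| + e) * (i.2 - i.1) <= (`|c| + e) * e.
  rewrite -mulr_sumr ler_wpM2l ?addr_ge0// ?ltW//.
  by rewrite (big_nth (0, 0)) big_mkord (lt_le_trans sumL)// ge_min lexx orbT.
move: XL; rewrite big_split/= subr0; have := normr_ge0 c.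
have : e * e <= e by rewrite -[leRHS]mulr1 ler_wpM2l// ltW.
lra.
Qed.

End AbsolutelyContinuous.

(** * Time translation of null sets and derivatives *)

Section Concatenation.
Context {R : realType}.

Lemma measurable_shift (a : R) :
  measurable_fun setT ((fun x => x - a) : measurableTypeR R -> measurableTypeR R).
Proof.
apply: measurable_realfun.continuous_measurable_fun => x.
by apply: cvgB; [exact: cvg_id|exact: cvg_cst].
Qed.

(** The pushforward under translation agrees with Lebesgue measure on half-open intervals, and these
    determine the measure. *)
Lemma lebesgue_measure_shift (A : set R) (a : R) : measurable A ->
  lebesgue_measure ((fun x => x - a) @^-1` A) = lebesgue_measure A.
Proof.
move=> mA.
pose nu := measure_function_pushforward__canonical__measure_function_Measure
  (@lebesgue_measure R) (measurable_shift a).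
rewrite [RHS](@lebesgue_measure_unique R nu)//.
move=> X /ocitvP[->|[[x y] /= xy ->]]; first by rewrite !measure0.
rewrite [RHS](_ : _ = lebesgue_measure (`]x + a, y + a]%classic : set R)).
  rewrite !lebesgue_measure_itv/= !lte_fin ltrD2r xy.
  by rewrite -!EFinB; congr (_%:E); ring.
congr lebesgue_measure.
by apply/seteqP; split=> z /=; rewrite !in_itv/= => /andP[? ?]; apply/andP; split; lra.
Qed.

Lemma ae_lebesgue_shift (P : R -> Prop) (a : R) :
  {ae @lebesgue_measure R, forall t, P t} ->
  {ae @lebesgue_measure R, forall t, P (t - a)}.
Proof.
move=> [A [mA A0 AP]]; exists ((fun x => x - a) @^-1` A); split.
- by rewrite -[X in measurable X]setTI; exact: measurable_shift.
- by rewrite -[RHS]A0; exact: lebesgue_measure_shift.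
- by move=> t; exact: AP.
Qed.

Lemma ae_lebesgueS (P Q : R -> Prop) : (forall t, P t -> Q t) ->
  {ae @lebesgue_measure R, forall t, P t} ->
  {ae @lebesgue_measure R, forall t, Q t}.
Proof. exact: (@filterS _ _ (ae_filter_ringOfSetsType (@lebesgue_measure R))). Qed.

Lemma derive1_shift (V : normedModType R) (f : R -> V) (a t : R) :
  derivable f (t - a) 1 -> derivable (fun s => f (s - a)) t 1 /\
    derive1 (fun s => f (s - a)) t = derive1 f (t - a).
Proof.
move=> df; split.
  move: df; rewrite /derivable [X in cvg (X @ _) -> _](_ : _ =
    (fun h : R => h^-1 *: (((fun s => f (s - a)) \o shift t) (h *: 1) - f (t - a))))//.
  by apply/funext => h /=; rewrite addrA.
rewrite /derive1 [X in lim (X @ _) = _](_ : _ =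
  (fun h : R => h^-1 *: (f (h + (t - a)) - f (t - a))))//.
by apply/funext => h /=; rewrite addrA.
Qed.

End Concatenation.

(** * Prefixing a segment to a trajectory *)

Section TrajectoryConcatenation.
Context {R : realType} {N : nat} (H : 'rV[R]_N -> 'rV[R]_N -> R).
Implicit Types (X : R -> 'rV[R]_N) (x v : 'rV[R]_N) (a b s t tau : R).

Lemma abs_continuousD X Y a b : abs_continuous a b X ->
  abs_continuous a b Y -> abs_continuous a b (fun t => X t + Y t).
Proof.
move=> aX aY e e0; have e20 : 0 < e / 2 by rewrite divr_gt0.
have [d d0 dX] := aX _ e20; have [d' d'0 dY] := aY _ e20.
exists (Num.min d d') => [|n s t st dst]; first by rewrite lt_min d0.
rewrite lt_min => /andP[sd sd'].
have := dX n s t st dst sd; have := dY n s t st dst sd'.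
suff : \sum_(i < n) enorm (X (t i) + Y (t i) - (X (s i) + Y (s i))) <=
  \sum_(i < n) enorm (X (t i) - X (s i)) + \sum_(i < n) enorm (Y (t i) - Y (s i)).
  lra.
rewrite -big_split ler_sum// => i _.
by rewrite opprD addrACA enormD.
Qed.

Lemma lipschitz_abs_continuous X a b (k : R) : 0 <= k ->
  (forall s t, s <= t -> enorm (X t - X s) <= k * (t - s)) ->
  abs_continuous a b X.
Proof.
move=> k0 Xk e e0; exists (e / (k + 1)) => [|n s t st _].
  by rewrite divr_gt0// ltr_wpDl.
rewrite ltr_pdivlMr ?ltr_wpDl// => h; apply: le_lt_trans h.
rewrite mulrDr mulr1 mulr_suml -big_split/= ler_sum// => i _.
have [_ sti _] := st i.
by rewrite (le_trans (Xk _ _ sti))// mulrC lerDl subr_ge0.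
Qed.

(** The time change is nondecreasing and 1-Lipschitz, so it maps disjoint families of small total
    length to families of the same kind. *)
Lemma abs_continuous_delay X tau t0 b : 0 <= t0 ->
  abs_continuous 0 (Num.max (b - tau) 0 + t0) X ->
  abs_continuous 0 b (fun s => X (Num.max (s - tau) 0 + t0)).
Proof.
move=> t00 aX e e0; have [d d0 dX] := aX e e0.
exists d => // n s t st /trivIsetP dst sd.
pose phi s := Num.max (s - tau) 0 + t0.
have phi_le a c : a <= c -> phi a <= phi c.
  by move=> ac; rewrite lerD2r le_max2 ?lerD2r.
have phi_lip a c : a <= c -> phi c - phi a <= c - a.
  move=> ac; rewrite /phi opprD addrACA subrr addr0.
  by rewrite /Num.max; case: ifP; case: ifP => /= *; lra.
apply: (dX n (phi \o s) (phi \o t)).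
- move=> i; have [s0 sti tb] := st i; split; [|exact: phi_le|exact: phi_le].
  by rewrite /= addr_ge0// le_max lexx orbT.
- apply/trivIsetP => i j _ _ ij.
  have := dst i j I I ij; move=> /seteqP[dij _]; apply/seteqP; split=> // z [].
  (* Such a [z] exceeds [t0], where the time change is a translation with this inverse. *)
  rewrite /= !in_itv/= => zi zj; apply: (dij (z - t0 + tau)).
  have sub k : phi (s k) < z < phi (t k) -> s k < z - t0 + tau < t k.
    rewrite /phi /Num.max.
    by case: ifP; case: ifP => /= *; apply/andP; split; lra.
  by split; rewrite /= in_itv/=; exact: sub.
- by apply: le_lt_trans sd; apply: ler_sum => i _; have [_ /phi_lip] := st i.
Qed.

Lemma is_derive_line x v t : is_derive t (1 : R) (fun s => x + s *: v) v.
Proof.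
have cvg_v : h^-1 *: (((fun s => x + s *: v) \o shift t) (h *: 1) - (x + t *: v))
    @[h --> (0 : R)^'] --> v.
  apply: cvg_near_cst; near=> h => /=.
  have h0 : h != 0 by near: h; exact: nbhs_dnbhs_neq.
  rewrite [h%:A]mulr1 opprD addrACA subrr add0r -scalerBl addrK scalerA.
  by rewrite mulVf// scale1r.
by apply: DeriveDef; [apply/cvg_ex; exists v|exact: cvg_lim].
Unshelve. all: by end_near. Qed.

Lemma trajectory_concat X x v t0 tau : trajectory H X -> 0 <= t0 -> 0 <= tau ->
  x + tau *: v = X t0 ->
  (forall s, 0 <= s <= tau -> velocity_set H (x + s *: v) v) ->
  exists Y, [/\ trajectory H Y, Y 0 = x &
    forall s, t0 <= s -> Y (s - t0 + tau) = X s].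
Proof.
move=> [aX dX] t00 tau0 xv vH.
(* Each summand is constant while the other moves, so absolute continuity follows from that of a
   sum, without a case at the junction. *)
pose Y s := x + Num.min s tau *: v + (X (Num.max (s - tau) 0 + t0) - X t0).
have Y1 s : s <= tau -> Y s = x + s *: v.
  move=> st; rewrite /Y (min_idPl st) (max_idPr _) ?subr_le0// add0r subrr.
  by rewrite addr0.
have Y2 s : tau <= s -> Y s = X (s - (tau - t0)).
  move=> st; rewrite /Y (min_idPr st) (max_idPl _) ?subr_ge0// xv addrC subrK.
  by congr X; ring.
exists Y; split; first split.
- move=> T T0; rewrite /Y; apply: abs_continuousD.
    apply: (@lipschitz_abs_continuous _ _ _ (enorm v)); first exact: enorm_ge0.
    move=> s t st; rewrite opprD addrACA subrr add0r -scalerBl enormZ mulrC.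
    rewrite ler_wpM2l ?enorm_ge0//.
    by rewrite /Num.min; case: ifP; case: ifP => /= *; rewrite ler_norml; apply/andP; split; lra.
  apply: abs_continuousD.
    apply: abs_continuous_delay => //; apply: aX.
    by rewrite addr_ge0// le_max lexx orbT.
  by apply: (@lipschitz_abs_continuous _ _ _ 0) => // s t _; rewrite subrr enorm0 mul0r.
(* The possible corner at time [tau] is discarded as a null set. *)
- have ae_tau : {ae @lebesgue_measure R, forall t, t != tau}.
    exists [set tau]; split; [exact: measurable_set1|exact: lebesgue_measure_set1|].
    by move=> t /= /negP; rewrite negbK => /eqP.
  have ae_X := ae_lebesgue_shift (tau - t0) dX.
  have ae_filter := ae_filter_ringOfSetsType (@lebesgue_measure R).
  apply: (@filterS2 _ _ ae_filter _ _ _ _ ae_tau ae_X) => t tN dXt t0'.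
  have [ttau|taut|] := ltgtP t tau; last by move/eqP; rewrite (negPf tN).
    have YE : \forall s \near t, x + s *: v = Y s.
      near=> s; rewrite Y1//; apply: ltW; near: s; exact: lt_nbhsl.
    have := near_eq_is_derive YE (is_derive_line x v t) => -[dY Yv].
    split=> //; rewrite derive1E Yv Y1 ?ltW//.
    by apply: vH; rewrite t0' ltW.
  have [dXs Xv] : derivable X (t - (tau - t0)) 1 /\ velocity_set H (X (t - (tau - t0))) (derive1 X (t - (tau - t0))).
    by apply: dXt; lra.
  have YE : \forall s \near t, X (s - (tau - t0)) = Y s.
    near=> s; rewrite Y2//; apply: ltW; near: s; exact: lt_nbhsr.
  have [d1 d2] := derive1_shift dXs.
  split; first exact: near_eq_derivable YE d1.
  rewrite derive1E -(near_eq_derive _ YE) -derive1E d2 Y2//; exact: ltW.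
- by rewrite Y1// scale0r addr0.
- move=> s ts; rewrite Y2; last by lra.
  by congr X; ring.
Unshelve. all: by end_near. Qed.

End TrajectoryConcatenation.

(** * Estimates for the minimum time function *)

Section MinimumTime.
Context {R : realType} {N : nat} (H : 'rV[R]_N -> 'rV[R]_N -> R).
Context (C0 rmin rmax alpha : R).
Hypothesis sa : standing_assumptions H C0 rmin rmax alpha.
Hypothesis N_gt0 : (0 < N)%N.
Implicit Types (x y z p q v e w : 'rV[R]_N) (s t T L : R) (X : R -> 'rV[R]_N).

Let r0 : 0 < rmin := SA_rmin sa.
Let R0 : 0 < rmax := rmax_gt0 sa.

(** Relative error in [H] when the base point moves by at most [L]: dividing by [rmin] trades the
    factor [|p|] of the Hölder bound for [H x p]. *)
Definition oscillation L : R := C0 * L `^ (2 * alpha) / rmin.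

Lemma oscillation_ge0 L : 0 <= oscillation L.
Proof. by rewrite divr_ge0 ?mulr_ge0 ?powR_ge0// ltW// (SA_C0 sa). Qed.

Lemma H_oscillation x y p L : enorm (x - y) <= L ->
  `|H x p - H y p| <= oscillation L * H x p.
Proof.
move=> xyL; rewrite (le_trans (SA_holder sa x y p))//.
have C0ge0 : 0 <= C0 := ltW (SA_C0 sa).
have xL : enorm (x - y) `^ (2 * alpha) <= L `^ (2 * alpha).
  have /andP[a0 _] := SA_alpha sa.
  apply: ge0_ler_powR; rewrite ?nnegrE ?enorm_ge0//; first by lra.
  exact: le_trans (enorm_ge0 _) xyL.
apply: (@le_trans _ _ (C0 * L `^ (2 * alpha) * enorm p)).
  by rewrite ler_wpM2r ?enorm_ge0// ler_wpM2l.
rewrite /oscillation -[leRHS]mulrA ler_wpM2l ?mulr_ge0 ?powR_ge0//.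
by rewrite ler_pdivlMl// (H_ge sa).
Qed.

Lemma enorm_trajectory_le X t : trajectory H X -> 0 <= t ->
  enorm (X t - X 0) <= rmax * t.
Proof.
move=> [aX dX] t0; apply: enorm_le; last by rewrite mulr_ge0// ltW.
move=> p p1; rewrite dotBr; apply: ac_increment_le => //; first exact: aX.
apply: ae_lebesgueS dX => s dXs /andP[s0 _]; have [dX1 Xv] := dXs s0; split=> //.
rewrite dotC (le_trans (velocity_set_le sa p Xv))//.
by rewrite (le_trans (H_le sa _ _))// p1 mulr1.
Qed.

(** Up to time [t] the arc stays within [rmax * t] of [X 0], so its velocities obey the support
    bound at [X 0] enlarged by the oscillation. The result bounds the gauge of the displacement. *)
Lemma trajectory_mean_velocity X t q : trajectory H X -> 0 <= t ->
  dot (X t - X 0) q <= t * (1 + oscillation (rmax * t)) * H (X 0) q.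
Proof.
move=> tX t0; move: q; apply: (support_le_sphere sa) => p p1.
rewrite dotC dotBr -mulrA mulrC; have [aX dX] := tX.
apply: ac_increment_le => //; first exact: aX.
apply: ae_lebesgueS dX => s dXs /andP[s0 st]; have [dX1 Xv] := dXs s0; split=> //.
rewrite dotC (le_trans (velocity_set_le sa p Xv))//.
have Xs : enorm (X 0 - X s) <= rmax * t.
  by rewrite enormBC (le_trans (enorm_trajectory_le tX s0))// ler_wpM2l// ltW.
have := H_oscillation p Xs; rewrite ler_norml => /andP[h _].
by rewrite mulrDl mul1r; lra.
Qed.

Context (Omega : set 'rV[R]_N) (u : 'rV[R]_N -> R).
Hypothesis u_solution : dirichlet_solution H Omega u.

Lemma solution_le x t : closure Omega x -> hitting_times H Omega x t -> u x <= t.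
Proof.
move=> /u_solution ux xt; rewrite -lee_fin ux.
by apply: ereal_inf_lbound; exists t.
Qed.

Lemma le_solution x (c : R) : closure Omega x ->
  (forall t, hitting_times H Omega x t -> c <= t) -> c <= u x.
Proof.
move=> /u_solution ux xc; rewrite -lee_fin ux; apply: le_ereal_inf_tmp.
by move=> _ [t xt <-]; rewrite lee_fin xc.
Qed.

Lemma solution_ge0 x : closure Omega x -> 0 <= u x.
Proof. by move=> cx; apply: le_solution => // t []. Qed.

Lemma near_optimal x (e : R) : closure Omega x -> 0 < e ->
  exists2 t, hitting_times H Omega x t & t < u x + e.
Proof.
move=> cx e0; have : ((u x)%:E < (u x + e)%:E)%E by rewrite lte_fin ltrDl.
rewrite {1}(u_solution cx) => /ereal_inf_lt[_ [t xt <-]].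
by rewrite lte_fin => ?; exists t.
Qed.

(* Following a segment from [x] to [X t] costs the gauge of [X t - x] for the
   frozen velocity set at [z], up to the factor coming from the oscillation. *)
Lemma solution_le_segment x z X t T s L : closure Omega x -> trajectory H X ->
  0 <= t -> t <= T -> boundary Omega (X T) -> 0 < s ->
  (forall q, dot (X t - x) q <= s * H z q) ->
  enorm (x - z) <= L -> enorm (X t - z) <= L -> oscillation L <= 1 / 2 ->
  u x <= s * (1 + 2 * oscillation L) + (T - t).
Proof.
move=> cx tX t0 tT XT s0 sH xL XL a12.
have a0 := oscillation_ge0 L; set a := oscillation L in a0 a12 *.
(* Slowing down by [1 + 2 a] compensates the change of base point, because [(1 + 2 a) (1 - a) >= 1]
   when [0 <= a <= 1/2]. *)
pose tau := s * (1 + 2 * a); have tau0 : 0 < tau by rewrite mulr_gt0//; lra.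
have [|s1 s1tau|Y [tY Y0 YX]] := @trajectory_concat _ _ H X x
    (tau^-1 *: (X t - x)) t tau tX t0 (ltW tau0).
- by rewrite scalerA mulfV ?gt_eqF// scale1r addrC subrK.
- pose l := s1 / tau.
  have l01 : 0 <= l <= 1.
    case/andP: s1tau => s10 s1tau.
    by rewrite divr_ge0 ?(ltW tau0)//= ler_pdivrMr// mul1r.
  rewrite scalerA -/l; apply: (le_velocity_set sa) => // q.
  have yL : enorm (z - (x + l *: (X t - x))) <= L.
    have -> : z - (x + l *: (X t - x)) =
        (1 - l) *: (z - x) + l *: (z - X t).
      by rewrite !scalerBr !scalerBl !scale1r; apply/rowP => i; rewrite !mxE; ring.
    rewrite (le_trans (enormD _ _))// !enormZ (enormBC z x) (enormBC z).
    case/andP: l01 => l0 l1; rewrite !ger0_norm ?subr_ge0//.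
    have l1' : 0 <= 1 - l by rewrite subr_ge0.
    by have := ler_wpM2l l0 XL; have := ler_wpM2l l1' xL; lra.
  have := H_oscillation q yL; rewrite ler_norml -/a => /andP[_ h].
  rewrite dotZl ler_pdivrMl//.
  have Hz : 0 <= H z q.
    by rewrite (le_trans _ (H_ge sa z q))// mulr_ge0 ?enorm_ge0// ltW.
  apply: (le_trans (sH q)); apply: (@le_trans _ _ (tau * ((1 - a) * H z q))).
    have -> : tau * ((1 - a) * H z q) = s * ((1 + 2 * a) * (1 - a) * H z q).
      by rewrite /tau; ring.
    rewrite ler_pM2l// -[leLHS]mul1r ler_wpM2r//.
    have : 0 <= a * (1 / 2 - a) by rewrite mulr_ge0// subr_ge0.
    lra.
  by rewrite ler_pM2l//; lra.
have -> : s * (1 + 2 * a) + (T - t) = T - t + tau by rewrite addrC.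
apply: solution_le => //; split; first by rewrite addr_ge0 ?subr_ge0// ltW.
by exists Y; split=> //; rewrite YX.
Qed.

(** Velocities of norm [rmin] are admissible everywhere, so the segment from [x] to [y] can precede
    a nearly optimal trajectory from [y]. The segment may leave [Omega]: [hitting_times] constrains
    only the final point. *)
Lemma solution_lipschitz x y : closure Omega x -> closure Omega y ->
  u x <= u y + enorm (y - x) / rmin.
Proof.
move=> cx cy; apply/ler_addgt0Pr => e e0.
have [T [T0 [X [tX X0 XT]]] Tu] := near_optimal cy e0.
pose tau := enorm (y - x) / rmin.
have tau0 : 0 <= tau by rewrite divr_ge0 ?enorm_ge0// ltW.
have [xy|xy] := eqVneq y x.
  by rewrite -xy subrr enorm0 mul0r addr0 (le_trans _ (ltW Tu))// solution_le//;
    split=> //; exists X.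
have yx : 0 < enorm (y - x) by rewrite enorm_gt0 subr_eq0.
have [|s1 s1tau|Y [tY Y0 YX]] := @trajectory_concat _ _ H X x
    (tau^-1 *: (y - x)) 0 tau tX (lexx 0) tau0.
- rewrite scalerA mulfV ?gt_eqF ?divr_gt0// scale1r X0.
  by rewrite addrC subrK.
- apply: (le_velocity_set sa) => // q.
  apply: le_trans (H_ge sa _ q); apply: (le_trans (dot_le _ _)).
  rewrite ler_wpM2r ?enorm_ge0// enormZ ger0_norm ?invr_ge0//.
  by rewrite invf_div divfK// gt_eqF.
have : u x <= T + tau; last by rewrite /tau; lra.
apply: solution_le => //; split; first by rewrite addr_ge0.
by exists Y; split=> //; have := YX T T0; rewrite subr0 => ->.
Qed.

(** From time [t] on, one nearly optimal trajectory of the midpoint serves both endpoints. The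
    first-order changes of the gauge toward [x] and [y] cancel, leaving its second difference and
    the oscillation. *)
Lemma midpoint_estimate x y t : let e := 2^-1 *: (x - y) in
  let z := 2^-1 *: (x + y) in
  closure Omega x -> closure Omega y -> closure Omega z ->
  0 < t -> t <= u z -> enorm e <= rmax * t ->
  2 * gauge_curvature rmin rmax * rmin * enorm e <= t ->
  oscillation (rmax * t) <= 1 / 2 ->
  u x + u y - 2 * u z <= 8 * t * oscillation (rmax * t) +
    8 * gauge_curvature rmin rmax * enorm e ^+ 2 / t.
Proof.
move=> e z cx cy cz t0 tz eR et a12.
have a0 := oscillation_ge0 (rmax * t); set a := oscillation _ in a0 a12 *.
set k := gauge_curvature rmin rmax in et *; set E := enorm e in eR et *.
have xE : x = z + e.
  by apply/rowP => i; rewrite /z /e !mxE; field.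
have yE : y = z - e.
  by apply/rowP => i; rewrite /z /e !mxE; field.
have k0 : 0 <= k by rewrite divr_ge0 ?sqr_ge0.
apply/ler_addgt0Pr => d d0; have d20 : 0 < d / 2 by rewrite divr_gt0.
have [T zT Tu] := near_optimal cz d20.
have tT : t <= T := le_trans tz (solution_le cz zT).
case: zT => T0 [X [tX X0 XT]].
have s0 : 0 < t * (1 + a) by rewrite mulr_gt0// ltr_wpDr.
have ts : t <= t * (1 + a) by rewrite -[leLHS]mulr1 ler_pM2l// lerDl.
have Xz q : dot (X t - z) q <= t * (1 + a) * H z q.
  by have := trajectory_mean_velocity q tX (ltW t0); rewrite X0.
(* [X t - y] and [X t - x] are [X t - z] plus and minus [e]. *)
have [sg sgs [Xy Xx]] := gauge_semiconcave sa s0 Xz (le_trans et ts).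
rewrite -/k -/E in Xy Xx.
set s := t * (1 + a) in s0 ts Xz sgs Xy Xx.
have kE0 : 0 <= 2 * k * E ^+ 2 / s.
  by rewrite divr_ge0 ?(ltW s0)// mulr_ge0 ?sqr_ge0// mulr_ge0.
have kEs : 2 * k * E ^+ 2 / s <= 2 * k * E ^+ 2 / t.
  apply: ler_wpM2l; first by rewrite mulr_ge0 ?sqr_ge0// mulr_ge0.
  by rewrite lef_pV2.
(* This keeps [s - sg] and [s + sg] positive, as [solution_le_segment] requires. *)
have [sg1 sg2] : - (s / 2) <= sg /\ sg <= s / 2.
  by move: sgs; rewrite ler_norml => /andP.
have XtL : enorm (X t - z) <= rmax * t.
  by rewrite -X0 enorm_trajectory_le// ltW.
have ux : u x <= (s - sg + 2 * k * E ^+ 2 / s) * (1 + 2 * a) + (T - t).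
  apply: (@solution_le_segment x z X t T _ (rmax * t)) => //.
  - exact: ltW.
  - by lra.
  - by move=> q; have := Xx q; rewrite xE opprD addrA.
  - by rewrite xE addrC addKr.
have uy : u y <= (s + sg + 2 * k * E ^+ 2 / s) * (1 + 2 * a) + (T - t).
  apply: (@solution_le_segment y z X t T _ (rmax * t)) => //.
  - exact: ltW.
  - by lra.
  - by move=> q; have := Xy q; rewrite yE opprB addrA addrAC.
  - by rewrite yE addrC addKr enormN.
have a_kE : (1 + 2 * a) * (2 * k * E ^+ 2 / s) <= 2 * (2 * k * E ^+ 2 / t).
  by rewrite ler_pM//; lra.
(* Hence [2 t ((1 + a) (1 + 2 a) - 1) <= 8 t a], the first error term. *)
have : t * (a * a) <= t * (a / 2) by rewrite ler_wpM2l ?(ltW t0)// ler_wpM2l//; lra.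
have -> : 8 * k * E ^+ 2 / t = 4 * (2 * k * E ^+ 2 / t) by ring.
move: a_kE kE0; rewrite /s in ux uy *.
move: (2 * k * E ^+ 2 / (t * (1 + a))) (2 * k * E ^+ 2 / t) ux uy => K1 K2 ux uy.
lra.
Qed.

End MinimumTime.

(** * From midpoint semiconcavity to semiconcavity *)

Section MidpointSemiconcavity.
Context {R : realType}.

(** The positive part [M] of the supremum satisfies [M <= M / 2 + c]; the a priori bound [B] makes
    it finite. *)
Lemma le_of_halving (T : Type) (A : set T) (g : T -> R) (B c : R) : 0 <= c ->
  (forall x, A x -> g x <= B) ->
  (forall M, 0 <= M -> (forall x, A x -> g x <= M) ->
     forall x, A x -> g x <= M / 2 + c) ->
  forall x, A x -> g x <= 2 * c.
Proof.
move=> c0 gB gM x Ax.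
pose S := g @` A; pose M := Num.max 0 (sup S).
have SB : has_ubound S by exists B => _ [y Ay <-]; exact: gB.
have gsup y : A y -> g y <= M.
  move=> Ay; rewrite le_max; apply/orP; right.
  by apply: (ub_le_sup SB); exists y.
have M0 : 0 <= M by rewrite le_max lexx.
have gM2 := gM M M0 gsup.
have : M <= M / 2 + c.
  rewrite {1}/M ge_max; apply/andP; split; first by lra.
  by apply: ge_sup => [|_ [y Ay <-]]; [exists (g x); exists x|exact: gM2].
by move: (gsup x Ax); lra.
Qed.

(** Multiplied by [K], this is the slope [a = 4 K + 2 b] of the barrier below, where [q = 2^theta]
    and [b] solves [b q = b + 2 q K]. *)
Definition halving_const (theta : R) : R :=
  4 + 2 * (2 * 2 `^ theta / (2 `^ theta - 1)).

Lemma two_powR_gt1 (theta : R) : 0 < theta -> 1 < 2 `^ theta.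
Proof.
move=> t0; have := @gt0_ltr_powR R theta t0 1 2; rewrite powR1.
by apply; rewrite ?nnegrE// ltr1n.
Qed.

(** As [l] is halved toward 0, the errors relative to [l] decrease geometrically with ratio
    [2^(-theta)], hence a linear bound. The hypothesis at the other end enters the preliminary
    uniform bound [2 K]. *)
Lemma le_linear_of_halving (g : R -> R) (B K theta : R) : 0 < theta -> 0 <= K ->
  (forall l, 0 <= l <= 1 -> g l <= B) ->
  (forall l, 0 <= l <= 1 -> g (l / 2) <= g l / 2 + K * l `^ (1 + theta)) ->
  (forall l, 0 <= l <= 1 ->
     g (1 - l / 2) <= g (1 - l) / 2 + K * l `^ (1 + theta)) ->
  forall l, 0 < l <= 1 -> g l <= halving_const theta * K * l.
Proof.
move=> t0 K0 gB gl gr.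
have p1 l : 0 <= l <= 1 -> l `^ (1 + theta) <= 1.
  move=> /andP[l0 l1]; apply: (@le_trans _ _ (1 `^ (1 + theta))); last by rewrite powR1.
  by apply: ge0_ler_powR; rewrite ?nnegrE//; lra.
have g2K : forall l, [set l | 0 <= l <= 1] l -> g l <= 2 * K.
  apply: (le_of_halving K0 gB) => M M0 gM l /= /andP[l0 l1].
  have [l2|l2] := lerP l (1 / 2).
    have l2' : 0 <= 2 * l <= 1 by apply/andP; split; lra.
    have := gl _ l2'; rewrite [2 * l / 2](_ : _ = l); last by field.
    have := gM _ l2'; have := ler_wpM2l K0 (p1 _ l2'); lra.
  have l2' : 0 <= 2 * (1 - l) <= 1 by apply/andP; split; lra.
  have l2'' : 0 <= 1 - 2 * (1 - l) <= 1 by apply/andP; split; lra.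
  have := gr _ l2'; rewrite [1 - 2 * (1 - l) / 2](_ : _ = l); last by field.
  have := gM _ l2''; have := ler_wpM2l K0 (p1 _ l2'); lra.
have q1 := two_powR_gt1 t0; set q := 2 `^ theta in q1.
pose b := K * (2 * q / (q - 1)); pose a := halving_const theta * K.
have b0 : 0 <= b by rewrite mulr_ge0// divr_ge0; lra.
have aE : a = 4 * K + 2 * b by rewrite /a /b /halving_const -/q; ring.
have bE : b * q = b + 2 * q * K.
  by rewrite /b; field; rewrite subr_eq0 gt_eqF.
(* the barrier [a l - b l^(1+theta)] absorbs the error of each halving step *)
have gD : forall l, [set l | 0 < l <= 1] l ->
    g l - (a * l - b * l `^ (1 + theta)) <= 2 * 0.
  apply: (@le_of_halving _ _ _ (2 * K + b)) => // [l /= /andP[l0 l1]|].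
    have l01 : 0 <= l <= 1 by rewrite ltW.
    have := g2K l l01; have := ler_wpM2l b0 (p1 _ l01).
    have : 0 <= a * l by rewrite mulr_ge0//; lra.
    lra.
  move=> M M0 gM l /= /andP[l0 l1]; rewrite addr0.
  have [l2|l2] := lerP l (1 / 2).
    have l2' : 0 < 2 * l <= 1 by apply/andP; split; lra.
    have l2'' : 0 <= 2 * l <= 1 by apply/andP; split; lra.
    have := gl _ l2''; rewrite [2 * l / 2](_ : _ = l); last by field.
    have := gM _ l2'.
    have -> : (2 * l) `^ (1 + theta) = 2 * q * l `^ (1 + theta).
      rewrite powRM ?(ltW l0)// powRD ?powRr1//.
      by apply/implyP => _; rewrite pnatr_eq0.
    have := congr1 (fun z => z * l `^ (1 + theta)) bE.
    lra.
  (* For [l > 1/2] the uniform bound is enough, as [a l >= a / 2 = 2 K + b]. *)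
  have l01 : 0 <= l <= 1 by rewrite ltW.
  have := g2K l l01; have := ler_wpM2l b0 (p1 _ l01).
  have := ler_wpM2l (_ : 0 <= a) (ltW l2); lra.
move=> l l01; have := gD l l01; rewrite mulr0 -/a.
have : 0 <= b * l `^ (1 + theta) by rewrite mulr_ge0 ?powR_ge0.
lra.
Qed.

(** Along a segment the concavity defect [g] vanishes at both ends and inherits the midpoint
    inequality, so it is bounded linearly near each end; moreover [min(l, 1 - l) <= 2 l (1 - l)]. *)
Lemma midpoint_semiconcave (N : nat) (theta : R) (O : set 'rV[R]_N)
    (v : 'rV[R]_N -> R) (B K : R) : 0 < theta -> 0 <= K ->
  convex_set (O : set (convex_lmodType 'rV[R]_N)) ->
  (forall x, O x -> 0 <= v x <= B) ->
  (forall x y, O x -> O y -> v x + v y - 2 * v (2^-1 *: (x + y)) <=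
     K * enorm (x - y) `^ (1 + theta)) ->
  exists C : R, forall (x y : 'rV[R]_N) (lambda : R),
    O x -> O y -> 0 <= lambda <= 1 ->
    lambda * v x + (1 - lambda) * v y
      - C * lambda * (1 - lambda) * (enorm (x - y) `^ (1 + theta))
    <= v (lambda *: x + (1 - lambda) *: y).
Proof.
move=> t0 K0 Oconv vB vmid.
have Oc x y l : O x -> O y -> 0 <= l <= 1 -> O (l *: x + (1 - l) *: y).
  move=> Ox Oy /andP[l0 l1]; apply: set_mem.
  exact: (Oconv _ _ (Itv01 l0 l1) (mem_set Ox) (mem_set Oy)).
pose C := halving_const theta; have C0 : 0 <= C.
  have := two_powR_gt1 t0; rewrite /C /halving_const => q1.
  by rewrite addr_ge0// mulr_ge0// divr_ge0//; lra.
have half x y l : O x -> O y -> 0 <= l <= 1 -> l <= 1 / 2 ->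
  l * v x + (1 - l) * v y - v (l *: x + (1 - l) *: y) <=
    C * (K / 2 * enorm (x - y) `^ (1 + theta)) * l.
  move=> Ox Oy /andP[l0 l1] l2.
  have [->|l_neq0] := eqVneq l 0.
    by rewrite scale0r mul0r !add0r subr0 scale1r mul1r subrr mulr0.
  pose g l := l * v x + (1 - l) * v y - v (l *: x + (1 - l) *: y).
  (* The part of [g] affine in its argument cancels in this difference. *)
  have mid s t : 0 <= s <= 1 -> 0 <= t <= 1 -> g ((s + t) / 2) <=
      (g s + g t) / 2 + K / 2 * enorm (x - y) `^ (1 + theta) * `|s - t| `^ (1 + theta).
    move=> s01 t01; have := vmid _ _ (Oc _ _ _ Ox Oy s01) (Oc _ _ _ Ox Oy t01).
    have -> : 2^-1 *: (s *: x + (1 - s) *: y + (t *: x + (1 - t) *: y)) =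
       ((s + t) / 2) *: x + (1 - (s + t) / 2) *: y.
      by apply/rowP => i; rewrite !mxE; field.
    have -> : s *: x + (1 - s) *: y - (t *: x + (1 - t) *: y) = (s - t) *: (x - y).
      by apply/rowP => i; rewrite !mxE; ring.
    rewrite enormZ powRM ?enorm_ge0//; rewrite /g; lra.
  apply: (@le_linear_of_halving g B _ theta t0).
  - by rewrite mulr_ge0 ?powR_ge0// divr_ge0.
  - move=> s s01; have /andP[v0 _] := vB _ (Oc _ _ _ Ox Oy s01).
    have /andP[_ vx] := vB _ Ox; have /andP[_ vy] := vB _ Oy.
    have [s0 s1] := andP s01; have s1' : 0 <= 1 - s by rewrite subr_ge0.
    by have := ler_wpM2l s0 vx; have := ler_wpM2l s1' vy; rewrite /g; lra.
  - move=> s s01; have [s0 s1] := andP s01.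
    have := mid s 0 s01; rewrite lexx ler01 addr0 subr0 (ger0_norm s0) => /(_ isT).
    have -> : g 0 = 0 by rewrite /g scale0r mul0r !add0r subr0 scale1r mul1r subrr.
    lra.
  - move=> s s01; have [s0 s1] := andP s01.
    have s01' : 0 <= 1 - s <= 1 by apply/andP; split; lra.
    have := mid (1 - s) 1 s01'; rewrite lexx ler01 => /(_ isT).
    have -> : (1 - s + 1) / 2 = 1 - s / 2 by field.
    have -> : 1 - s - 1 = - s by ring.
    rewrite normrN (ger0_norm s0).
    have -> : g 1 = 0 by rewrite /g subrr scale0r mul0r !addr0 scale1r mul1r subrr.
    lra.
  - by rewrite lt_neqAle eq_sym l_neq0 l0.
(* The [1/2] in [K / 2] offsets the 2 in [l <= 2 l (1 - l)] for [l <= 1/2]; the other half follows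
   by exchanging [x] and [y]. *)
exists (C * K) => x y l Ox Oy l01; have [l0 l1] := andP l01.
have E0 : 0 <= C * (K / 2 * enorm (x - y) `^ (1 + theta)).
  by rewrite mulr_ge0// mulr_ge0 ?powR_ge0// divr_ge0.
have [l2|l2] := lerP l (1 / 2).
  have := half x y l Ox Oy l01 l2.
  have : 0 <= (C * (K / 2 * enorm (x - y) `^ (1 + theta))) * (l * (1 - 2 * l)).
    by rewrite mulr_ge0// mulr_ge0//; lra.
  lra.
have l01' : 0 <= 1 - l <= 1 by apply/andP; split; lra.
have := half y x (1 - l) Oy Ox l01' _; rewrite (_ : 1 - l <= 1 / 2); last by lra.
move=> /(_ isT); rewrite enormBC subKr addrC (addrC ((1 - l) * v y)).
have : 0 <= (C * (K / 2 * enorm (x - y) `^ (1 + theta))) * ((1 - l) * (2 * l - 1)).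
  by rewrite mulr_ge0// mulr_ge0//; lra.
rewrite (addrC ((1 - l) *: y)); lra.
Qed.

End MidpointSemiconcavity.

(** * Bounds for [u] on compact subsets of [Omega] *)

Section LocalBounds.
Context {R : realType}.

Lemma powR_small (b c : R) : 0 < b -> 0 < c ->
  exists2 h0, 0 < h0 & forall h, 0 <= h <= h0 -> h `^ b <= c.
Proof.
move=> b0 c0; exists (c `^ b^-1); first exact: powR_gt0.
move=> h /andP[h0 hc]; have -> : c = (c `^ b^-1) `^ b.
  by rewrite -powRrM mulVf ?gt_eqF// powRr1// ltW.
by apply: ge0_ler_powR; rewrite ?nnegrE ?powR_ge0// ltW.
Qed.

Context {N : nat}.

(** Half the radius of a ball inside [Omega] is a margin valid for all nearby centres, and
    compactness makes it uniform. *)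
Lemma compact_margin (O Omega : set 'rV[R]_N) : compact O -> open Omega ->
  O `<=` Omega ->
  exists2 d, 0 < d & forall z w, O z -> enorm (w - z) < d -> Omega w.
Proof.
move=> cO oOmega OOmega.
have /compact_near_coveringP/(_ R (0 : R)^'+
  (fun d z => forall w : 'rV[R]_N, `|w - z| < d -> Omega w) _) := cO.
case.
  move=> z Oz; have /nbhs_ballP[e /= e0 eO] := open_nbhs_nbhs (conj oOmega (OOmega _ Oz)).
  have e20 : 0 < e / 2 by rewrite divr_gt0.
  exists (ball z (e / 2), [set d | d < e / 2]).
    by split=> /=; [exact: nbhsx_ballx|exact: nbhs_right_lt].
  move=> [z' d] /= [zz' de] w wz'; apply: eO.
  move: zz'; rewrite -!ball_normE/= => zz'.
  rewrite -(subrK z' z) -addrA (le_lt_trans (ler_normD _ _))//.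
  rewrite (splitr e) ltrD// distrC (lt_trans wz')//.
move=> d /= d0 dO; exists (d / 2); first by rewrite divr_gt0.
move=> z w Oz wz; apply: (dO (d / 2) _ _ z Oz w); rewrite /=.
- by rewrite sub0r normrN gtr0_norm ?divr_gt0// ltr_pdivrMr// mulr2n; lra.
- by rewrite divr_gt0.
- by rewrite (le_lt_trans (ler_norm_enorm _)).
Qed.

Context (H : 'rV[R]_N -> 'rV[R]_N -> R) (C0 rmin rmax alpha : R).
Hypothesis sa : standing_assumptions H C0 rmin rmax alpha.
Hypothesis N_gt0 : (0 < N)%N.
Context (Omega O : set 'rV[R]_N) (u : 'rV[R]_N -> R).
Hypothesis Omega_open : open Omega.
Hypothesis u_solution : dirichlet_solution H Omega u.
Hypothesis O_compact : compact O.
Hypothesis O_Omega : O `<=` Omega.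

Let O_closure x : O x -> closure Omega x.
Proof. by move=> /O_Omega; exact: subset_closure. Qed.

(** Speed is at most [rmax], so covering the margin [d] takes time at least [d / rmax]. This leaves
    room for an intermediate time [t <= u z]. *)
Lemma solution_bounded_below :
  exists2 m, 0 < m & forall z, O z -> m <= u z.
Proof.
have R0 := rmax_gt0 sa.
have [d d0 dO] := compact_margin O_compact Omega_open O_Omega.
exists (d / rmax); first by rewrite divr_gt0.
move=> z Oz; apply: (le_solution u_solution (O_closure Oz)).
move=> t [t0 [X [tX X0 [_ Xt]]]]; rewrite ler_pdivrMr// leNgt; apply/negP => td.
apply: Xt; have /interior_id -> := Omega_open; apply: (dO z) => //.
by rewrite -X0 (le_lt_trans (enorm_trajectory_le sa tX t0))// mulrC.
Qed.

Lemma solution_bounded_above :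
  exists2 B, 0 <= B & forall z, O z -> u z <= B.
Proof.
have r0 := SA_rmin sa.
have [[x0 Ox0]|O0] := pselect (exists x, O x); last first.
  by exists 0 => // z Oz; exfalso; apply: O0; exists z.
have [M [_ OM]] := compact_bounded O_compact.
have {}OM z : O z -> enorm z <= N%:R * (`|M| + 1).
  move=> Oz; rewrite (le_trans (ler_enorm_norm _))// ler_wpM2l//.
  by apply: (OM (`|M| + 1)) => //; rewrite (le_lt_trans (ler_norm M))// ltrDl.
exists (u x0 + 2 * (N%:R * (`|M| + 1)) / rmin) => [|z Oz].
  rewrite addr_ge0//; first exact: (solution_ge0 u_solution (O_closure Ox0)).
  by apply: divr_ge0 (ltW r0); rewrite mulr_ge0// mulr_ge0// addr_ge0.
rewrite (le_trans (solution_lipschitz sa N_gt0 u_solution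
  (O_closure Oz) (O_closure Ox0)))//.
rewrite lerD2l ler_wpM2r ?invr_ge0 ?(ltW r0)//.
by rewrite (le_trans (enormB _ _))//; have := OM _ Oz; have := OM _ Ox0; lra.
Qed.

End LocalBounds.

(** * Choice of the time scale and conclusion *)

Theorem theorem5p1 (R : realType) (N : nat) (N_ge1 : (1 <= N)%N)
    (H : 'rV[R]_N -> 'rV[R]_N -> R)
    (H_continuous : continuous (fun z : 'rV[R]_N * 'rV[R]_N => H z.1 z.2))
    (C0 rmin rmax alpha : R)
    (H_SA : standing_assumptions H C0 rmin rmax alpha)
    (Omega : set 'rV[R]_N) (Omega_open : open Omega)
    (u : 'rV[R]_N -> R) (u_solution : dirichlet_solution H Omega u) :
  forall theta : R, 0 < theta < alpha / (4 + alpha) ->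
    locally_semiconcave theta Omega u.
Proof.
move=> theta /andP[t0 t1] O O_compact O_convex O_Omega.
have [r0 R0] := (SA_rmin H_SA, rmax_gt0 H_SA).
have /andP[a0 a1] := SA_alpha H_SA.
have ta : theta * (4 + alpha) < alpha by rewrite -ltr_pdivlMr//; lra.
have tta : 0 < theta * alpha by rewrite mulr_gt0.
have theta1 : theta < 1 by lra.
have clO x : O x -> closure Omega x by move=> /O_Omega; exact: subset_closure.
have [m m0 um] := solution_bounded_below H_SA Omega_open u_solution O_compact O_Omega.
have [B B0 uB] := solution_bounded_above H_SA N_ge1 u_solution O_compact O_Omega.
have Omid x y : O x -> O y -> O (2^-1 *: (x + y)).
  move=> Ox Oy; have h0 : 0 <= 2^-1 :> R by lra.
  have h1 : 2^-1 <= 1 :> R by lra.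
  have := O_convex _ _ (Itv01 h0 h1) (mem_set Ox) (mem_set Oy).
  move=> /set_mem; have -> // : 2^-1 *: (x + y) = 2^-1 *: x + (1 - 2^-1) *: y.
  by apply/rowP => i; rewrite !mxE; field.
pose k := gauge_curvature rmin rmax.
have k0 : 0 < k.
  have : 0 < 2 * rmax / rmin by rewrite divr_gt0// mulr_gt0.
  by move=> ?; rewrite divr_gt0 ?exprn_gt0//; lra.
pose Q := C0 * rmax `^ (2 * alpha) / rmin.
have Q0 : 0 < Q by rewrite divr_gt0 ?mulr_gt0 ?powR_gt0 ?(SA_C0 H_SA).
pose b := (1 - theta) * (2 * alpha).
have b0 : 0 < b by rewrite !mulr_gt0//; lra.
have theta1' : 0 < 1 - theta by rewrite subr_gt0.
(* The four thresholds secure, in order, [t <= u z], [|e| <= rmax t], the curvature condition and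
   [oscillation <= 1/2] in [midpoint_estimate]. *)
have [h1 h10 H1] := powR_small theta1' m0.
have R20 : 0 < 2 * rmax by rewrite mulr_gt0.
have [h2 h20 H2] := powR_small t0 R20.
have kr0 : 0 < (k * rmin)^-1 by rewrite invr_gt0 mulr_gt0.
have [h3 h30 H3] := powR_small t0 kr0.
have Q20 : 0 < (2 * Q)^-1 by rewrite invr_gt0 mulr_gt0.
have [h4 h40 H4] := powR_small b0 Q20.
pose h0 := Num.min 1 (Num.min (Num.min h1 h2) (Num.min h3 h4)).
have h0_gt0 : 0 < h0 by rewrite !lt_min ltr01 h10 h20 h30 h40.
have [h0_1 h0_h1 h0_h2 [h0_h3 h0_h4]] : [/\ h0 <= 1, h0 <= h1, h0 <= h2 & h0 <= h3 /\ h0 <= h4].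
  by have := lexx h0; rewrite {2}/h0 !le_min => /and3P[-> /andP[-> ->] /andP[-> ->]].
(* The first two terms come from [midpoint_estimate] with [|e| = h / 2]; the last one covers
   [h > h0] through the bound [B]. *)
pose K := 8 * Q + 2 * k + 2 * B / h0 `^ (1 + theta).
have K20 : 0 <= 2 * B / h0 `^ (1 + theta) by rewrite divr_ge0 ?powR_ge0// mulr_ge0.
have K0 : 0 <= K by rewrite /K; lra.
apply: (@midpoint_semiconcave _ _ _ O u B K) => // [x Ox|x y Ox Oy].
  by rewrite uB// (solution_ge0 u_solution (clO _ Ox)).
have [->|xy] := eqVneq x y.
  rewrite subrr enorm0 powR0 ?mulr0; last by lra.
  have -> : 2^-1 *: (y + y) = y by apply/rowP => i; rewrite !mxE; field.
  lra.
set h := enorm (x - y); have h_gt0 : 0 < h by rewrite enorm_gt0 subr_eq0.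
have Oz := Omid _ _ Ox Oy.
have hp0 : 0 <= h `^ (1 + theta) := powR_ge0 _ _.
have [hh0|hh0] := lerP h h0; last first.
  have := solution_ge0 u_solution (clO _ Oz).
  have := uB _ Ox; have := uB _ Oy.
  have : 2 * B <= 2 * B / h0 `^ (1 + theta) * h `^ (1 + theta).
    rewrite mulrAC ler_pdivlMr ?powR_gt0// ler_wpM2l ?mulr_ge0//.
    by apply: ge0_ler_powR; rewrite ?nnegrE; lra.
  have : 0 <= (8 * Q + 2 * k) * h `^ (1 + theta) by rewrite mulr_ge0//; lra.
  rewrite /K; lra.
have hle i : h0 <= i -> 0 <= h <= i by move=> hi; rewrite (ltW h_gt0) (le_trans hh0).
have {}H1 := H1 h (hle _ h0_h1); have {}H2 := H2 h (hle _ h0_h2).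
have {}H3 := H3 h (hle _ h0_h3); have {}H4 := H4 h (hle _ h0_h4).
(* With this scale [h^2 / t] is exactly [h^(1 + theta)]. *)
pose t := h `^ (1 - theta).
have t_gt0 : 0 < t by exact: powR_gt0.
have hD c d : h `^ (c + d) = h `^ c * h `^ d.
  by rewrite powRD//; apply/implyP => _; rewrite gt_eqF.
have ht : h = h `^ theta * t.
  by rewrite /t -hD addrC subrK powRr1// ltW.
have eE : enorm (2^-1 *: (x - y)) = h / 2 by rewrite enormZ gtr0_norm// mulrC.
have oE : oscillation C0 rmin alpha (rmax * t) = Q * h `^ b.
  by rewrite /oscillation powRM ?(ltW R0) ?(ltW t_gt0)// -powRrM /Q -/b; ring.
have h2t : h ^+ 2 / t = h `^ (1 + theta).
  apply: (canLR (mulfK _)); first by rewrite gt_eqF.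
  rewrite -hD (_ : 1 + theta + (1 - theta) = 2%:R); last by ring.
  by rewrite powR_mulrn// ltW.
have osc12 : oscillation C0 rmin alpha (rmax * t) <= 1 / 2.
  rewrite oE; have := ler_wpM2l (ltW Q0) H4.
  by rewrite invfM mulrCA mulfV ?gt_eqF// mulr1 div1r.
have eR : enorm (2^-1 *: (x - y)) <= rmax * t.
  by rewrite eE; have := ler_wpM2r (ltW t_gt0) H2; rewrite -ht; lra.
have ek : 2 * k * rmin * enorm (2^-1 *: (x - y)) <= t.
  have kr_neq0 : k * rmin != 0 by rewrite gt_eqF// mulr_gt0.
  have kr_ge0 : 0 <= k * rmin by rewrite mulr_ge0// ltW.
  rewrite eE; have := ler_wpM2l kr_ge0 (ler_wpM2r (ltW t_gt0) H3).
  by rewrite -ht mulrA mulfV// mul1r; lra.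
have := midpoint_estimate H_SA N_ge1 u_solution (clO _ Ox) (clO _ Oy) (clO _ Oz)
  t_gt0 (le_trans H1 (um _ Oz)) eR ek osc12.
(* Since [h <= 1], this amounts to [(1 - theta) (1 + 2 alpha) >= 1 + theta], that is
   [theta (1 + alpha) <= alpha]. *)
have thb : t * h `^ b <= h `^ (1 + theta).
  rewrite /t -hD; apply: ger_powR; last by rewrite /b; lra.
  by rewrite h_gt0 (le_trans hh0).
rewrite -/k eE oE.
have -> : 8 * k * (h / 2) ^+ 2 / t = 2 * k * (h ^+ 2 / t) by field; rewrite gt_eqF.
rewrite h2t => est.
have := ler_wpM2l (ltW Q0) thb; have := mulr_ge0 K20 hp0.
rewrite /K; lra.
Qed.
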